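(* Let $m\in\mathbb{N}$ with $\gcd(m,6)=3$ and $m=3^{k-1}l$ with $l$ odd, $\gcd(3,l)=1$ and $k\ge 2$. The correspondence $$\tilde{\alpha}_q\mapsto\Bigl(w,\tfrac{3m-1}{2}q\Bigr),\qquad \tilde{\varrho}_q\mapsto\Bigl(v,\tfrac{3m-1}{2}q+\tfrac{3m+1}{2}\Bigr),\qquad \tilde{\varsigma}_q\mapsto\Bigl(u,\tfrac{m-1}{2}q+1\Bigr)$$ gives an isomorphism between the following two McKay quivers. (1) The McKay quiver $Q_{\rho_{\mathrm{NAT}}}(P'_{8\cdot3^k}\times\mathbf{C}_l)$, given by the vertices $\tilde\alpha_q,\tilde\varrho_q$ ($0\le q<3^kl=3m$) and $\tilde\varsigma_q$ ($0\le q<3^{k-1}l=m$), and the arrows $$\tilde\alpha_q\to\tilde\varrho_{q+1};\qquad \tilde\varrho_q\to\tilde\alpha_{q+1},\ \ \tilde\varrho_q\to\tilde\varsigma_{q+1};\qquad \tilde\varsigma_q\to\tilde\varrho_{q+1},\ \ \tilde\varsigma_q\to\tilde\varrho_{3^{k-1}l+q+1},\ \ \tilde\varsigma_q\to\tilde\varrho_{2\cdot3^{k-1}l+q+1}.$$ (2) The McKay quiver $Q_{\rho_{\mathrm{Nat}}}(\mathbb{T}_m)$, given by the vertices $(u,i)$ ($0\le i<m$), $(v,i)$ and $(w,i)$ ($0\le i<3m$), and the arrows $$(w,i)\to(v,i);\qquad (v,i)\to(w,i-1),\ \ (v,i)\to(u,i);\qquad (u,i)\to(v,i-1),\ \ (u,i)\to(v,m+i-1),\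 \ (u,i)\to(v,2m+i-1).$$ Indices of $\tilde\alpha,\tilde\varrho,v,w$ are taken modulo $3m$, and indices of $\tilde\varsigma,u$ modulo $m$.
   Context: The McKay quiver $Q_\rho(G)$ of a finite group $G$ relative to a complex representation $\rho$ has one vertex for each irreducible representation $\rho_i$ of $G$, and $a_{ij}$ arrows from $\rho_i$ to $\rho_j$, where $\rho\otimes\rho_i=\bigoplus_j a_{ij}\rho_j$. All arrows listed in the claim have multiplicity one. Write $\zeta_n=e^{2\pi i/n}$; $\mathbf{C}_n$ is the cyclic group of order $n$, identified with the $n$-th roots of unity. The group $P'_{8\cdot3^k}=\langle x,y,z\mid x^2=(xy)^2=y^2,\ zxz^{-1}=y,\ zyz^{-1}=xy,\ z^{3^k}=1\rangle$ has order $8\cdot3^k$. Its irreducible representations are: - one-dimensional $\alpha_i$, $0\le i<3^k$: $\alpha_i(x)=\alpha_i(y)=1$, $\alpha_i(z)=\zeta_{3^k}^i$; - two-dimensional $\varrho_i$, $0\le i<3^k$: $\varrho_i(x)=\begin{pmatrix}0&\zeta_3^2\\-\zeta_3&0\end{pmatrix}$, $\varrho_i(y)=\begin{pmatrix}\zeta_3^2&1\\\zeta_3^2&-\zeta_3^2\end{pmatrix}$, $\varrho_i(z)=\zeta_{3^k}^i\begin{pmatrix}0&\zeta_3\\-\zeta_3^2&-1\end{pmatrix}$; - three-dimensional $\varsigma_s$, $0\le s<3^{k-1}$: $\varsigma_s(x)=\begin{pmatrix}-1&-1&-1\\0&0&1\\0&1&0\end{pmatrix}$, $\varsigma_s(y)=\begin{pmatrix}0&0&1\\-1&-1&-1\\1&0&0\end{pmatrix}$,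 $\varsigma_s(z)=\zeta_{3^k}^s\begin{pmatrix}-1&-1&-1\\0&1&0\\1&0&0\end{pmatrix}$. The irreducible representations of $\mathbf{C}_l$ are $\beta_j(\zeta_l)=\zeta_l^j$, $0\le j<l$. Those of $P'_{8\cdot3^k}\times\mathbf{C}_l$ are the products $\alpha_i\times\beta_j$, $\varrho_i\times\beta_j$, $\varsigma_s\times\beta_j$. The natural representation is $\rho_{\mathrm{NAT}}=\varrho_1\otimes\beta_1$. The paper renames these as follows. For $0\le i<3^k$, $0\le j<l$, let $p=i-j \bmod l$ (so $0\le p<l$) and $q=3^kp+i \bmod 3^kl$, and set $\tilde\alpha_q=\alpha_i\times\beta_j$, $\tilde\varrho_q=\varrho_i\times\beta_j$. For $0\le s<3^{k-1}$, $0\le j<l$, let $p=s-j \bmod l$ and $q=3^kp+s \bmod 3^{k-1}l$, and set $\tilde\varsigma_q=\varsigma_s\times\beta_j$. The paper asserts that with this renaming the McKay quiver is the one displayed in (1). The group $\mathbb{T}_m\subset U(2)$ is the small tetrahedral group of order $24m$ consisting of the products $\lambda\gamma$ with $\lambda\in\mathbf{C}_{6m}$ (as scalars), $\gamma\in\mathrm{B}\mathbf{T}$ and $\phi([\lambda])=[\gamma]$. Here $\mathrm{B}\mathbf{T}\subset SU(2)$ is the binary tetrahedral group (order 24), $\mathrm{B}\mathbf{D}_4$ is its normal binary dihedral subgroup of order 8, and $\phi\colon\mathbf{C}_{6m}/\mathbf{C}_{2m}\to\mathrm{B}\mathbf{T}/\mathrm{B}\mathbf{D}_4$ is an isomorphism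 (of groups of order three). The representation $\rho_{\mathrm{Nat}}$ of $\mathbb{T}_m$ is the inclusion in $U(2)$. One has $\mathbb{T}_m\cong P'_{8\cdot3^k}\times\mathbf{C}_l$. The description (2) of its McKay quiver is due to Auslander and Reiten.
   Formalization: The renaming q=3^k p+i, p=i−j mod l, yields quiver (1) only if l divides 3^k+1 (it fails for k=2, l=7); it is asserted in that case, and for all k, l the index used is q≡i mod 3^k (resp. q≡s mod 3^{k−1}) and q≡j mod l. *)

(* Defs.v *)
(* MathComp; complex representations are representations over algC *)
From HB Require Import structures.
From mathcomp Require Export all_boot all_order all_algebra all_fingroup.
From mathcomp Require Export all_solvable all_field all_character.

Set Implicit Arguments.
Unset Strict Implicit.
Unset Printing Implicit Defensive.

Import GroupScope GRing.Theory Num.Theory.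
Local Open Scope ring_scope.

(* A quiver is determined up to isomorphism by the number [arrows v w] of arrows
   from v to w. *)
Record quiver := Quiver {
  vertex :> Type;
  arrows : vertex -> vertex -> nat
}.

Definition quiver_iso (Q R : quiver) (f : Q -> R) : Prop :=
  bijective f /\ forall v w : Q, arrows (f v) (f w) = arrows v w.

(* [standard_irr_coef r] gives the multiplicities of the irreducible
   representations in the decomposition of r, cf. [mx_rsim_standard]. *)
Definition mckay_quiver (gT : finGroupType) (G : {group gT}) (n : nat)
    (rho : mx_representation algC G n) : quiver :=
  @Quiver (Iirr G) (fun i j =>
    standard_irr_coef (prod_repr rho 'Chi_i) (socle_of_Iirr j)).

(* 'Z_n is the ring Z/n only for 1 < n, so the definitions below are meant for
   1 < m.  In the constructors Varsigma and Vtx_u the index is read modulo m,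
   in the others modulo 3 * m. *)
Inductive vertex_PC (m : nat) : Type :=
  | Alpha of 'Z_(3 * m)
  | Varrho of 'Z_(3 * m)
  | Varsigma of 'Z_m.

(* [i : nat] below is the representative of i in [0, 3m) or [0, m), which is
   then reduced modulo m or 3m. *)
Definition arrows_PC (m : nat) (s t : vertex_PC m) : nat :=
  match s, t with
  | Alpha q, Varrho r => r == q + 1
  | Varrho q, Alpha r => r == q + 1
  | Varrho q, Varsigma r => r == (q : nat)%:R + 1
  | Varsigma q, Varrho r =>
      ((r == (q : nat)%:R + 1)%R + (r == m%:R + (q : nat)%:R + 1)%R
       + (r == (2 * m)%:R + (q : nat)%:R + 1)%R)%N
  | _, _ => 0%N
  end.

Definition quiver_PC (m : nat) : quiver := Quiver (@arrows_PC m).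

Inductive vertex_T (m : nat) : Type :=
  | Vtx_w of 'Z_(3 * m)
  | Vtx_v of 'Z_(3 * m)
  | Vtx_u of 'Z_m.

Definition arrows_T (m : nat) (s t : vertex_T m) : nat :=
  match s, t with
  | Vtx_w i, Vtx_v j => j == i
  | Vtx_v i, Vtx_w j => j == i - 1
  | Vtx_v i, Vtx_u j => j == (i : nat)%:R
  | Vtx_u i, Vtx_v j =>
      ((j == (i : nat)%:R - 1)%R + (j == m%:R + (i : nat)%:R - 1)%R
       + (j == (2 * m)%:R + (i : nat)%:R - 1)%R)%N
  | _, _ => 0%N
  end.

Definition quiver_T (m : nat) : quiver := Quiver (@arrows_T m).

(* All three halvings are exact because m is odd. *)
Definition correspondence (m : nat) (s : quiver_PC m) : quiver_T m :=
  match s with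
  | Alpha q => Vtx_w (((3 * m - 1)./2)%:R * q)
  | Varrho q => Vtx_v (((3 * m - 1)./2)%:R * q + ((3 * m + 1)./2)%:R)
  | Varsigma q => Vtx_u (((m - 1)./2)%:R * q + 1)
  end.

(* P is the presented group, and x, y, z are generators of it that satisfy the
   relations.  [\isog Grp] alone would not name the generators. *)
Definition is_P' (k : nat) (gT : finGroupType) (P : {group gT}) (x y z : gT) :
    Prop :=
  [/\ P \isog Grp (x : y : z :
                     x ^+ 2 = (x * y) ^+ 2, (x * y) ^+ 2 = y ^+ 2,
                     z * x * z^-1 = y, z * y * z^-1 = x * y,
                     z ^+ (3 ^ k) = 1),
      P :=: <<[set x; y; z]>>,
      (x ^+ 2 = (x * y) ^+ 2)%g /\ ((x * y) ^+ 2 = y ^+ 2)%g,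
      (z * x * z^-1 = y)%g /\ (z * y * z^-1 = x * y)%g
    & (z ^+ (3 ^ k) = 1)%g].

Definition mx_of_seqs (n : nat) (s : seq (seq algC)) : 'M[algC]_n :=
  \matrix_(i, j) nth 0 (nth [::] s i) j.

(* The images of x, y, z under alpha_i, varrho_i, varsigma_s, in terms of a
   primitive cube root of unity w and the scalar e = zeta_{3^k}^i. *)
Definition alpha_x : 'M[algC]_1 := 1%:M.
Definition alpha_y : 'M[algC]_1 := 1%:M.
Definition alpha_z (e : algC) : 'M[algC]_1 := e%:M.

Definition varrho_x (w : algC) : 'M[algC]_2 :=
  mx_of_seqs 2 [:: [:: 0; w ^+ 2];
                   [:: - w; 0]].
Definition varrho_y (w : algC) : 'M[algC]_2 :=
  mx_of_seqs 2 [:: [:: w ^+ 2; 1];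
                   [:: w ^+ 2; - w ^+ 2]].
Definition varrho_z (w e : algC) : 'M[algC]_2 :=
  e *: mx_of_seqs 2 [:: [:: 0; w];
                        [:: - w ^+ 2; -1]].

Definition varsigma_x : 'M[algC]_3 :=
  mx_of_seqs 3 [:: [:: -1; -1; -1];
                   [:: 0; 0; 1];
                   [:: 0; 1; 0]].
Definition varsigma_y : 'M[algC]_3 :=
  mx_of_seqs 3 [:: [:: 0; 0; 1];
                   [:: -1; -1; -1];
                   [:: 1; 0; 0]].
Definition varsigma_z (e : algC) : 'M[algC]_3 :=
  e *: mx_of_seqs 3 [:: [:: -1; -1; -1];
                        [:: 0; 1; 0];
                        [:: 1; 0; 0]].

(* The generator c of C_l = <[c]> stands for zeta_l, so that beta_j sends c to
   b = zeta_l^j.  A representation of P x <[c]> is determined by its values on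
   the generators (x, 1), (y, 1), (z, 1), (1, c). *)
Definition PC (gT cT : finGroupType) (P : {group gT}) (c : cT) :
  {group gT * cT} := [group of setX P <[c]>].

Definition is_product_repr (gT cT : finGroupType) (P : {group gT})
    (x y z : gT) (c : cT) (n : nat) (X Y Z : 'M[algC]_n) (b : algC)
    (r : mx_representation algC (PC P c) n) : Prop :=
  [/\ r (x, 1%g) = X, r (y, 1%g) = Y, r (z, 1%g) = Z & r (1%g, c) = b%:M].

(* The irreducible representation of index v is the product of the
   representation (x, y, z) |-> (X, Y, Z) of P and of c |-> b. *)
Definition product_irr (gT cT : finGroupType) (P : {group gT})
    (x y z : gT) (c : cT) (n : nat) (X Y Z : 'M[algC]_n) (b : algC)
    (v : Iirr (PC P c)) : Prop :=
  exists2 r : mx_representation algC (PC P c) n,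
    is_product_repr x y z X Y Z b r & mx_rsim r 'Chi_v.

(* The vertices are named by alpha~_q = alpha_i x beta_j and
   varrho~_q = varrho_i x beta_j with q = idx i j, and by
   varsigma~_q = varsigma_s x beta_j with q = idx' s j. *)
Definition is_renaming (k l : nat) (zeta : nat -> algC)
    (gT cT : finGroupType) (P : {group gT}) (x y z : gT) (c : cT)
    (idx idx' : nat -> nat -> nat) (m : nat)
    (lab : quiver_PC m -> Iirr (PC P c)) : Prop :=
  let w := zeta 3%N in
  let e i := zeta (3 ^ k)%N ^+ i in
  let b j := zeta l ^+ j in
  (forall i j, (i < 3 ^ k)%N -> (j < l)%N ->
     product_irr x y z alpha_x alpha_y (alpha_z (e i)) (b j)
       (lab (Alpha (idx i j)%:R)) /\
     product_irr x y z (varrho_x w) (varrho_y w) (varrho_z w (e i)) (b j)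
       (lab (Varrho (idx i j)%:R))) /\
  (forall s j, (s < 3 ^ (k - 1))%N -> (j < l)%N ->
     product_irr x y z varsigma_x varsigma_y (varsigma_z (e s)) (b j)
       (lab (Varsigma (idx' s j)%:R))).

(* Tensoring with varrho_1 x beta_1 adds 1 to both indices (i, j), so the
   displayed arrows amount to q = i mod 3^k (resp. q = s mod 3^(k-1)) and
   q = j mod l.  The formula q = 3^k p + i with p = i - j mod l satisfies
   the first congruence always, the second one exactly when l divides
   3^k + 1. *)
Definition crt_index (k l i j : nat) : nat := chinese (3 ^ k) l i j.

(* For j < l, i + (l - j) is i - j modulo l without truncation. *)
Definition formula_index (k l i j : nat) : nat :=
  (3 ^ k * ((i + (l - j)) %% l) + i)%N.

Definition quat_i : 'M[algC]_2 := mx_of_seqs 2 [:: [:: 'i; 0];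
                                                   [:: 0; - 'i]].
Definition quat_j : 'M[algC]_2 := mx_of_seqs 2 [:: [:: 0; 'i];
                                                   [:: 'i; 0]].

(* The 8 elements of BD_4 and the 24 elements of BT in SU(2); BT is generated
   by BD_4 and by tau, which has order 6 and normalizes BD_4, and the three
   cosets of BD_4 are those of 1, tau and tau^2. *)
Definition BD4 : seq 'M[algC]_2 :=
  [seq s *: q | s <- [:: 1; -1], q <- [:: 1; quat_i; quat_j; quat_i * quat_j]].

Definition tau : 'M[algC]_2 :=
  2^-1 *: mx_of_seqs 2 [:: [:: 1 - 'i; 1 - 'i];
                           [:: - 1 - 'i; 1 + 'i]].

Definition BT : seq 'M[algC]_2 :=
  [seq tau ^+ n * d | n <- iota 0 3, d <- BD4].

Definition same_coset_BD4 (g h : 'M[algC]_2) : Prop := g^-1 * h \in BD4.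

Definition Cn (n : nat) : pred algC := fun a => a ^+ n == 1.

(* phi is a choice of representatives for a group isomorphism
   C_{6m} / C_{2m} -> BT / BD_4, [a] |-> [phi a].  The second and third
   conditions make it well defined, multiplicative and injective. *)
Definition represents_isomorphism (m : nat) (phi : algC -> 'M[algC]_2) :
    Prop :=
  [/\ forall a, Cn (6 * m) a -> phi a \in BT,
      forall a b, Cn (6 * m) a -> Cn (6 * m) b ->
        same_coset_BD4 (phi (a * b)) (phi a * phi b),
      forall a, Cn (6 * m) a -> (phi a \in BD4) = Cn (2 * m) a
    & forall g, g \in BT ->
        exists2 a, Cn (6 * m) a & same_coset_BD4 (phi a) g].

Definition in_T (m : nat) (phi : algC -> 'M[algC]_2) (M : 'M[algC]_2) : Prop :=
  exists a g, [/\ Cn (6 * m) a, g \in BT, same_coset_BD4 (phi a) g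
                & M = a *: g].

(* A finite group T together with its inclusion in U(2), rho_Nat = r, whose
   image is T_m. *)
Definition is_Tm (m : nat) (phi : algC -> 'M[algC]_2) (gT : finGroupType)
    (T : {group gT}) (r : mx_representation algC T 2) : Prop :=
  mx_faithful r /\
  forall M : 'M[algC]_2, (exists2 g, g \in T & r g = M) <-> in_T m phi M.

(* Main.v *)
(* Both groups are extensions of a cyclic group of order 3m by the quaternion
   group, and both natural representations r satisfy, with d = det r and
   t = tr r: d^(3m) = 1, t^2 is 0 or 4d where d^m = 1, and t^2 = d elsewhere.
   These identities alone determine the McKay quiver once the order of the group
   is at most 24m.  Let lam be the power of d with lam^2 = d and put
   rho = tr r / lam and sigma = rho^2 - 1.  Then
     |sigma|^2 = 1 + lam^m + lam^(2m) + 2 |rho|^2 - 2,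
   so sigma is irreducible along with rho, and the characters lam^q, lam^q rho
   (q mod 3m) and lam^q sigma (q mod m) are distinct; the sum of the squares of
   their degrees is 24m, so there are no others.  The arrows are read off
     rho * rho = 1 + sigma,  rho * sigma = rho (1 + lam^m + lam^(2m)).
   The three-dimensional matrices are those of the symmetric square of rho in a
   suitable basis. *)
Require Import Defs.
From mathcomp Require Import ring zify.

Set Implicit Arguments.
Unset Strict Implicit.
Unset Printing Implicit Defensive.

Import GroupScope Order.TTheory GRing.Theory Num.Theory.
Local Open Scope ring_scope.

(** * The McKay quiver of a tetrahedral representation *)

Lemma cfdot_pointwise (gT : finGroupType) (G : {group gT})
    (f1 f2 f3 f4 : 'CF(G)) :
  {in G, forall g, f1 g * (f2 g)^* = f3 g * (f4 g)^*} ->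
  '[f1, f2] = '[f3, f4].
Proof.
by move=> eqf; rewrite !cfdotE; congr (_ * _); apply: eq_bigr => g /eqf.
Qed.

(** A reducible character of degree 2 has only linear constituents, so its kernel contains the
    derived subgroup and its value at every commutator is 2. *)
Lemma irr_of_degree2 (gT : finGroupType) (G : {group gT}) (chi : 'CF(G)) x y :
  chi \is a character -> chi 1%g = 2 -> x \in G -> y \in G ->
  chi [~ x, y]%g != 2 -> chi \in irr G.
Proof.
move=> Nchi chi1 Gx Gy; apply: contraR => nirr.
have lin i : i \in irr_constt chi -> 'chi_i \is a linear_char.
  move=> ci; have [psi Npsi Echi] := constt_charP i Nchi ci.
  have := Cnat_irr1 i; case/natrP => d Ed.
  have d_gt0 : (0 < d)%N by rewrite -(ltr_nat algC) -Ed irr1_gt0.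
  have := char1_ge_constt Nchi ci; rewrite chi1 Ed ler_nat => d_le2.
  rewrite qualifE /= irr_char Ed; case: d Ed d_gt0 d_le2 => [|[|[|d]]] // Ed _ _;
    first exact: eqxx.
  case/negP: nirr; suff -> : chi = 'chi_i by apply: mem_irr.
  have/eqP: psi 1%g = 0.
    have := congr1 (fun f : 'CF(G) => f 1%g) Echi.
    rewrite cfunE chi1 Ed => /eqP.
    by rewrite addrC -subr_eq subrr eq_sym => /eqP.
  by rewrite char1_eq0 // => /eqP psi0; rewrite Echi psi0 addr0.
have Gxy : [~ x, y]%g \in G^`(1)%g by rewrite derg1 mem_commg.
have in_ker : G^`(1)%g \subset cfker chi.
  rewrite cfkerE // subsetI der_sub /=.
  by apply/bigcapsP => i /lin /lin_char_der1.
by rewrite (cfker1 (subsetP in_ker _ Gxy)) chi1.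
Qed.

(** The standard decomposition of the tensor product expands its character over the irreducible
    ones; orthonormality extracts the coefficient. Arrow counts thus become character
    computations. *)
Lemma arrows_mckayE (gT : finGroupType) (G : {group gT}) (n : nat)
    (rho : mx_representation algC G n) (i j : Iirr G) :
  (arrows (i : mckay_quiver rho) j)%:R = '[cfRepr rho * 'chi_i, 'chi_j].
Proof.
rewrite -[in RHS](irrRepr i) cfRepr_prod.
rewrite (cfRepr_sim (mx_rsim_standard _)) cfRepr_standard cfdot_suml (bigD1 j) //=.
rewrite cfdotZl cfdot_irr eqxx mulr1 big1 ?addr0 // => i' ne.
by rewrite cfdotZl cfdot_irr (negPf ne) mulr0.
Qed.

(** * Irreducible characters and McKay quiver from the values of [lam] and [rho] *)

Section TetrahedralCharacters.

Variables (gT : finGroupType) (G : {group gT}) (m : nat).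
Variables (lam rho : 'CF(G)) (t : gT).
Hypothesis m_gt1 : (1 < m)%N.
Hypothesis lin_lam : lam \is a linear_char.
Hypothesis irr_rho : rho \in irr G.
Hypothesis rho1 : rho 1%g = 2.
Hypothesis Gt : t \in G.
Hypothesis lam_t : (3 * m).-primitive_root (lam t).
Hypothesis lam_exp : {in G, forall g, lam g ^+ (3 * m) = 1}.
Hypothesis rho_ker :
  {in G, forall g, lam g ^+ m = 1 -> rho g = 0 \/ rho g ^+ 2 = 4}.
Hypothesis rho_nker : {in G, forall g, lam g ^+ m != 1 -> rho g ^+ 2 = 1}.
Hypothesis cardG : (#|G| <= 24 * m)%N.

Definition tetra_char (s : vertex_PC m) : 'CF(G) :=
  match s with
  | Alpha q => lam ^+ q
  | Varrho q => lam ^+ q * rho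
  | Varsigma q => lam ^+ q * (rho ^+ 2 - 1)
  end.

Let m3_gt1 : (1 < 3 * m)%N.
Proof. by rewrite (leq_trans m_gt1) ?leq_pmull. Qed.

Let not_dvd_m : ~~ (3 * m %| m)%N.
Proof. by rewrite gtnNdvd ?ltn_Pmull // (ltnW m_gt1). Qed.

Lemma lin_lamX n : lam ^+ n \is a linear_char.
Proof. exact: rpredX. Qed.

Lemma lamX_mod n : lam ^+ (n %% (3 * m)) = lam ^+ n.
Proof.
have lam3m : lam ^+ (3 * m) = 1.
  by apply/cfun_inP => g Gg; rewrite exp_cfunE // lam_exp // cfun1E Gg.
by rewrite [in RHS](divn_eq n (3 * m)) exprD [(_ %/ _ * _)%N]mulnC exprM
     lam3m expr1n mul1r.
Qed.

Lemma lamX_Zp n : lam ^+ (n%:R : 'Z_(3 * m)) = lam ^+ n.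
Proof. by rewrite val_Zp_nat // lamX_mod. Qed.

(** The only possible values are 0, 1, -1, 2 and -2. *)
Lemma rho_real : {in G, forall g, (rho g)^* = rho g}.
Proof.
move=> g Gg; have [/eqP k|k] := boolP (lam g ^+ m == 1).
  case: (rho_ker Gg k) => [->|R2]; first by rewrite conjC0.
  have/eqP: (rho g - 2) * (rho g + 2) = 0.
    by transitivity (rho g ^+ 2 - 4); [ring | rewrite R2 subrr].
  rewrite mulf_eq0 subr_eq0 addr_eq0 => /orP[]/eqP->.
    by rewrite rmorph_nat.
  by rewrite rmorphN rmorph_nat.
have := rho_nker Gg k => /eqP; rewrite sqrf_eq1 => /orP[]/eqP->.
  by rewrite conjC1.
by rewrite rmorphN1.
Qed.

Lemma lam_m_neq1 : lam ^+ m != 1.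
Proof.
apply/negP => /eqP/(congr1 (fun f : 'CF(G) => f t)).
rewrite exp_cfunE // cfun1E Gt => /eqP.
by rewrite -(prim_order_dvd lam_t) (negPf not_dvd_m).
Qed.

Lemma lam_cube_root g : g \in G -> lam g ^+ m != 1 ->
  1 + lam g ^+ m + lam g ^+ m ^+ 2 = 0.
Proof.
move=> Gg ne; apply: (mulIf (x := lam g ^+ m - 1)); first by rewrite subr_eq0.
have E : lam g ^+ m ^+ 3 = 1 by rewrite -exprM mulnC lam_exp.
by transitivity (lam g ^+ m ^+ 3 - 1); [ring | rewrite E subrr mul0r].
Qed.

(* On the kernel of [lam ^+ m], of index 3, [rho] takes the values 0 and +-2,
   and outside it [rho ^+ 2 = 1]. *)
Lemma sigma_norm : '[rho ^+ 2 - 1] = 1.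
Proof.
(* The sum 1 + lam^m + lam^(2m) is 3 on the kernel of lam^m and 0 elsewhere, so both sides agree
   pointwise: 1 or 9 on the kernel, 0 outside. *)
have -> : '[rho ^+ 2 - 1] =
    '[1 + lam ^+ m + lam ^+ m ^+ 2 + (rho * rho + rho * rho) - 1 - 1, 1].
  apply: cfdot_pointwise => g Gg; rewrite !cfunE !exp_cfunE // ?cfunE !cfun1E Gg /=.
  rewrite -!expr2 !conjC1 mulr1 rmorphB rmorphXn /= conjC1 rho_real //.
  have [/eqP k|k] := boolP (lam g ^+ m == 1).
    by rewrite k; case: (rho_ker Gg k) => [->|R2]; [|rewrite -!expr2 R2]; ring.
  by rewrite lam_cube_root // -!expr2 (rho_nker Gg k); ring.
have lin_norm0 (xi : 'CF(G)) : xi \is a linear_char -> xi != 1 -> '[xi, 1] = 0.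
  move=> lxi nxi; have := lin_char_irr lxi => /irrP[i Ei].
  rewrite Ei -(irr0 G) cfdot_irr; case: eqP => // i0.
  by rewrite Ei i0 irr0 eqxx in nxi.
have rr : '[rho * rho, 1] = 1.
  have /irrP[i Ei] := irr_rho.
  rewrite -(_ : '[rho] = 1); last by rewrite Ei cfdot_irr eqxx.
  apply: cfdot_pointwise => g Gg.
  by rewrite !cfunE cfun1E Gg conjC1 mulr1 rho_real.
have one1 : '[1 : 'CF(G), 1] = 1 by rewrite -(irr0 G) cfdot_irr eqxx.
(* As lam^(3m) = 1, triviality of lam^(2m) would force that of lam^m. *)
have ne2 : lam ^+ m ^+ 2 != 1.
  apply: contra lam_m_neq1 => /eqP E2.
  rewrite -[lam ^+ m]mulr1 -[X in _ * X]E2 -exprS -exprM mulnC.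
  by rewrite -lamX_mod modnn expr0.
rewrite !cfdotBl !cfdotDl one1 rr !lin_norm0 ?lam_m_neq1 ?rpredX //.
by ring.
Qed.

(** A virtual character of norm 1 is irreducible up to sign, and the degree 3 is positive. *)
Lemma sigma_irr : rho ^+ 2 - 1 \in irr G.
Proof.
have Zs : rho ^+ 2 - 1 \in 'Z[irr G].
  by rewrite rpredB ?rpred1 ?cfun1_vchar // rpredX // char_vchar ?irrWchar.
have [b [i Ei]] := vchar_norm1P Zs sigma_norm.
have := congr1 (fun f : 'CF(G) => f 1%g) Ei.
case: b Ei => Ei; last by rewrite Ei scale1r mem_irr.
rewrite !cfunE cfun11 rho1 expr1 mulN1r => E3.
have := irr1_gt0 i; rewrite -oppr_lt0 -E3.
suff -> : 2 * 2 - 1 = 3%:R :> algC by rewrite ltrn0.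
by ring.
Qed.

Lemma tetra_char_irr s : tetra_char s \in irr G.
Proof.
case: s => q /=; first by rewrite lin_char_irr ?lin_lamX.
  by rewrite mul_lin_irr ?lin_lamX.
by rewrite mul_lin_irr ?lin_lamX ?sigma_irr.
Qed.

Definition tetra_degree (s : vertex_PC m) : nat :=
  match s with Alpha _ => 1 | Varrho _ => 2 | Varsigma _ => 3 end.

Lemma tetra_char1 s : tetra_char s 1%g = (tetra_degree s)%:R.
Proof.
case: s => q /=; rewrite ?cfunE ?(lin_char1 (lin_lamX _)) // mul1r //.
by rewrite rho1 cfun11; ring.
Qed.

(** Degrees separate the three families. Within the first two, the value at [t] recovers the index.
    The third vanishes at [t], so it is evaluated at [t ^+ 3], where [lam] has order m and rho^2 is
    0 or 4. *)
Lemma tetra_char_inj : injective tetra_char.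
Proof.
have val_lt n (q : 'Z_n) : (1 < n)%N -> (q < n)%N.
  by move=> n_gt1; rewrite -[X in (_ < X)%N](Zp_cast n_gt1) ltn_ord.
have prim_inj n (u : algC) (q r : 'Z_n) : (1 < n)%N ->
    n.-primitive_root u -> u ^+ q = u ^+ r -> q = r.
  move=> n_gt1 pu /eqP; rewrite (eq_prim_root_expr pu) => /eqP.
  by rewrite !modn_small ?val_lt // => /val_inj.
have Gt3 : (t ^+ 3)%g \in G by rewrite groupX.
have lam_t3 : m.-primitive_root (lam (t ^+ 3)%g).
  rewrite (lin_charX lin_lam) //.
  have := exp_prim_root lam_t 3; rewrite (gcdn_idPl _) ?dvdn_mulr //.
  by rewrite mulKn.
have lam_t_ne1 : lam t ^+ m != 1.
  by rewrite -(prim_order_dvd lam_t).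
have rho_t : rho t != 0.
  by rewrite -(sqrf_eq0 (rho t)) (rho_nker Gt lam_t_ne1) oner_eq0.
have sigma_t3 : rho (t ^+ 3)%g * rho (t ^+ 3)%g - 1 != 0.
  rewrite -expr2.
  case: (rho_ker Gt3 (prim_expr_order lam_t3)) => [->|->].
    by rewrite expr0n /= sub0r oppr_eq0 oner_eq0.
  by rewrite -(natrB _ (isT : 1 <= 4)%N) pnatr_eq0.
move=> s s' E.
have/eqP := congr1 (fun f : 'CF(G) => f 1%g) E.
rewrite !tetra_char1 eqr_nat => /eqP.
case: s s' E => q [] r //= E _; congr (_ _).
- have/= := congr1 (fun f : 'CF(G) => f t) E; rewrite !exp_cfunE //.
  exact: prim_inj.
- have/= := congr1 (fun f : 'CF(G) => f t) E; rewrite !cfunE !exp_cfunE //.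
  by move/(mulIf rho_t); apply: prim_inj.
- have/= := congr1 (fun f : 'CF(G) => f (t ^+ 3)%g) E.
  rewrite !cfunE !exp_cfunE // cfun1E Gt3.
  by move/(mulIf sigma_t3); apply: prim_inj.
Qed.

Definition tetra_irr (s : vertex_PC m) : Iirr G := cfIirr (tetra_char s).

Lemma tetra_irrE s : 'chi_(tetra_irr s) = tetra_char s.
Proof. by rewrite cfIirrE ?tetra_char_irr. Qed.

Lemma tetra_irr_inj : injective tetra_irr.
Proof.
move=> s s' E; apply: tetra_char_inj.
by rewrite -!tetra_irrE E.
Qed.

(** Presents the vertices by a finite type, so that they can be counted and summed over. *)
Definition vertex_PC_of_sum (u : 'Z_(3 * m) + 'Z_(3 * m) + 'Z_m) : vertex_PC m :=
  match u with
  | inl (inl q) => Alpha q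
  | inl (inr q) => Varrho q
  | inr q => Varsigma q
  end.

Lemma vertex_PC_of_sum_bij : bijective vertex_PC_of_sum.
Proof.
exists (fun s => match s with
  | Alpha q => inl (inl q) | Varrho q => inl (inr q) | Varsigma q => inr q end).
  by do 2?case.
by case.
Qed.

Lemma tetra_irr_bij : bijective tetra_irr.
Proof.
have [h hK Kh] := vertex_PC_of_sum_bij.
pose f u := tetra_irr (vertex_PC_of_sum u).
have f_inj : injective f by move=> u v /tetra_irr_inj /(can_inj hK).
suff f_bij : bijective f.
  apply: (eq_bij (f := f \o h)); last by move=> s; rewrite /= /f Kh.
  by apply: bij_comp => //; exists vertex_PC_of_sum.
apply: inj_card_bij => //.
(* The count is 3m + 4 * 3m + 9m. *)
have sumV : \sum_u 'chi_(f u) 1%g ^+ 2 = (24 * m)%:R.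
  under eq_bigr => u _ do rewrite tetra_irrE tetra_char1 -natrX.
  rewrite !big_sumType /= !sumr_const !card_ord !Zp_cast //.
  by rewrite -!mulrnA -!natrD; congr _%:R; lia.
pose V := [set f u | u in setT].
have sumV' : \sum_(i in V) 'chi_i 1%g ^+ 2 = (24 * m)%:R.
  rewrite big_imset /=; last by move=> u v _ _ /f_inj.
  by rewrite -sumV; apply: eq_bigl => u; rewrite inE.
have VT i : i \in V.
  (* A missing irreducible character would add a positive square and push the order of G above
     24m. *)
  apply: contraLR cardG => notVi; rewrite -ltnNge -(ltr_nat algC) -irr_sum_square.
  rewrite (bigID (mem V)) /= sumV' ltrDl (bigD1 i) //=.
  rewrite ltr_wpDr ?exprn_gt0 ?irr1_gt0 //.
  by apply: sumr_ge0 => j _; rewrite exprn_ge0 // ltW ?irr1_gt0.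
rewrite -[X in (_ <= X)%N]cardsT -(card_imset _ f_inj) subset_leq_card //.
by apply/subsetP => i _; apply: VT.
Qed.

(** The factor rho^2 - 1 vanishes wherever lam^m differs from 1. This is why the index of [Varsigma]
    only matters modulo m. *)
Lemma sigmaM_lam : lam ^+ m * (rho ^+ 2 - 1) = rho ^+ 2 - 1.
Proof.
apply/cfun_inP => g Gg; rewrite !cfunE exp_cfunE // cfun1E Gg.
have [/eqP ->|k] := boolP (lam g ^+ m == 1); first by rewrite mul1r.
by rewrite -expr2 (rho_nker Gg k) subrr mulr0.
Qed.

Lemma tetra_char_AlphaE n : tetra_char (Alpha n%:R) = lam ^+ n.
Proof. exact: lamX_Zp. Qed.

Lemma tetra_char_VarrhoE n : tetra_char (Varrho n%:R) = lam ^+ n * rho.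
Proof. by rewrite /= lamX_Zp. Qed.

Lemma tetra_char_VarsigmaE n :
  tetra_char (Varsigma n%:R) = lam ^+ n * (rho ^+ 2 - 1).
Proof.
have mulX d : lam ^+ (m * d) * (rho ^+ 2 - 1) = rho ^+ 2 - 1.
  elim: d => [|d IHd]; first by rewrite muln0 mul1r.
  by rewrite mulnS exprD -mulrA IHd sigmaM_lam.
rewrite /= val_Zp_nat // [in RHS](divn_eq n m) exprD [(_ %/ _ * _)%N]mulnC.
by rewrite mulrAC mulX mulrC.
Qed.

Lemma mul_rho_Alpha q :
  lam * rho * tetra_char (Alpha q) = tetra_char (Varrho (q + 1)).
Proof.
by rewrite -[q in RHS]natr_Zp natr1 tetra_char_VarrhoE exprS /=; ring.
Qed.

Lemma mul_rho_Varrho q :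
  lam * rho * tetra_char (Varrho q) =
  tetra_char (Alpha (q + 1)) + tetra_char (Varsigma ((q : nat)%:R + 1)).
Proof.
rewrite -[q in Alpha (q + 1)]natr_Zp !natr1.
by rewrite tetra_char_AlphaE tetra_char_VarsigmaE exprS /=; ring.
Qed.

Lemma mul_rho_Varsigma q :
  lam * rho * tetra_char (Varsigma q) =
  tetra_char (Varrho ((q : nat)%:R + 1)) +
  tetra_char (Varrho (m%:R + (q : nat)%:R + 1)) +
  tetra_char (Varrho ((2 * m)%:R + (q : nat)%:R + 1)).
Proof.
rewrite -!natrD !natr1 !tetra_char_VarrhoE !exprS [(2 * m)%N]mulnC !exprD exprM /=.
(* Without the common power of [lam], the claim is rho (rho^2 - 1) = (1 + lam^m + lam^(2m)) rho:
   both sides are 3 rho on the kernel of lam^m and 0 elsewhere. *)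
transitivity (lam ^+ q * lam * ((1 + lam ^+ m + lam ^+ m ^+ 2) * rho)); last by ring.
transitivity (lam ^+ q * lam * (rho * (rho ^+ 2 - 1))); first by ring.
congr (_ * _); apply/cfun_inP => g Gg.
rewrite !cfunE !exp_cfunE // !cfun1E Gg -!expr2 /=.
have [/eqP k|k] := boolP (lam g ^+ m == 1).
  by rewrite k; case: (rho_ker Gg k) => ->; ring.
by rewrite (rho_nker Gg k) lam_cube_root //; ring.
Qed.

Lemma tetra_irr_mckay (r : mx_representation algC G 2) :
  cfRepr r = lam * rho ->
  quiver_iso (tetra_irr : quiver_PC m -> mckay_quiver r).
Proof.
move=> Er; split; first exact: tetra_irr_bij.
have dot s s' : '[tetra_char s, tetra_char s'] = (tetra_irr s == tetra_irr s')%:R.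
  by rewrite -!tetra_irrE cfdot_irr.
have eq_irr s s' : (tetra_irr s == tetra_irr s') =
    match s, s' with
    | Alpha q, Alpha r => r == q
    | Varrho q, Varrho r => r == q
    | Varsigma q, Varsigma r => r == q
    | _, _ => false
    end.
  apply/eqP/idP => [/tetra_irr_inj|].
    by case: s => q; case: s' => q' // [->].
  by case: s => q; case: s' => q' // /eqP->.
move=> s s'; apply/eqP; rewrite -(eqr_nat algC); apply/eqP.
rewrite arrows_mckayE Er !tetra_irrE.
by case: s => q; rewrite ?mul_rho_Alpha ?mul_rho_Varrho ?mul_rho_Varsigma;
  rewrite ?cfdotDl !dot -?natrD; case: s' => r'; rewrite !eq_irr ?addn0 // !natrD.
Qed.
End TetrahedralCharacters.

(** * From a two-dimensional representation to [lam] and [rho] *)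

Lemma det_reprE (gT : finGroupType) (G : {group gT}) n
    (r : mx_representation algC G n) g :
  g \in G -> detRepr r g = \det (r g).
Proof. by move=> Gg; rewrite cfunE Gg mulr1n /= mxtrace_scalar. Qed.

(* A square root of the linear character [detRepr r], whose order divides the
   odd number [3 * m]. *)
Definition sqrt_det (gT : finGroupType) (G : {group gT}) (m : nat)
    (r : mx_representation algC G 2) : 'CF(G) :=
  detRepr r ^+ (3 * m).+1./2.

(** The properties shared by both natural representations. The element [t] gives the determinant its
    full order 3m; the commutator of trace other than 2 forces irreducibility. *)
Definition tetra_repr (gT : finGroupType) (G : {group gT}) (m : nat)
    (r : mx_representation algC G 2) : Prop :=
  [/\ {in G, forall g, \det (r g) ^+ (3 * m) = 1},
      {in G, forall g, \det (r g) ^+ m = 1 ->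
         \tr (r g) = 0 \/ \tr (r g) ^+ 2 = 4 * \det (r g)},
      {in G, forall g, \det (r g) ^+ m != 1 -> \tr (r g) ^+ 2 = \det (r g)},
      exists2 t, t \in G & (3 * m).-primitive_root (\det (r t))
    & exists x y, [/\ x \in G, y \in G & \tr (r [~ x, y]%g) != 2]].

Section TetrahedralRepresentation.

Variables (gT : finGroupType) (G : {group gT}) (m : nat).
Variable r : mx_representation algC G 2.
Hypotheses (m_gt1 : (1 < m)%N) (m_odd : odd m).
Hypothesis r_tetra : tetra_repr m r.
Hypothesis cardG : (#|G| <= 24 * m)%N.

Let lam : 'CF(G) := sqrt_det m r.
(** Conjugation inverts a linear character, so this is the trace divided by [lam]. *)
Let rho : 'CF(G) := lam^*%CF * cfRepr r.

Lemma sqrt_det_lin : lam \is a linear_char.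
Proof. by rewrite rpredX // detRepr_lin_char. Qed.

(** As 3m is odd, twice the exponent is 3m + 1, and the determinant to the power 3m is 1. *)
Lemma sqrt_detK g : g \in G -> lam g ^+ 2 = \det (r g).
Proof.
move=> Gg; have [Dexp _ _ _ _] := r_tetra.
rewrite exp_cfunE // det_reprE // -exprM muln2 halfK oddS.
by rewrite oddM m_odd /= subn0 exprS Dexp // mulr1.
Qed.

Lemma sqrt_det_exp : {in G, forall g, lam g ^+ (3 * m) = 1}.
Proof.
move=> g Gg; have [Dexp _ _ _ _] := r_tetra.
by rewrite exp_cfunE // det_reprE // exprAC Dexp // expr1n.
Qed.

(** Here lam^m is a cube root of unity whose square is the m-th power of the determinant; a cube
    root of unity is 1 once its square is. *)
Lemma sqrt_det_exp_m g : g \in G -> (lam g ^+ m == 1) = (\det (r g) ^+ m == 1).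
Proof.
move=> Gg; rewrite -sqrt_detK // exprAC; apply/eqP/eqP => [->|E2].
  by rewrite expr1n.
have := sqrt_det_exp Gg; rewrite mulnC exprM exprS.
by rewrite E2 mulr1.
Qed.

Lemma cfRepr_tetra : cfRepr r = lam * rho.
Proof. by rewrite mulrA mul_conjC_lin_char ?sqrt_det_lin // mul1r. Qed.

Lemma rho_sqr g : g \in G -> \det (r g) * rho g ^+ 2 = \tr (r g) ^+ 2.
Proof.
move=> Gg; rewrite -sqrt_detK // -exprMn; congr (_ ^+ 2).
have : (lam * rho) g = \tr (r g) by rewrite -cfRepr_tetra cfunE Gg.
by rewrite cfunE.
Qed.

Lemma det_neq0 g : g \in G -> \det (r g) != 0.
Proof. by move=> /(repr_mx_unit r); rewrite unitmxE unitfE. Qed.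

Lemma tetra_rho_irr : rho \in irr G.
Proof.
have [_ _ _ _ [x [y [Gx Gy tr_xy]]]] := r_tetra.
rewrite mul_lin_irr ?cfConjC_lin_char ?sqrt_det_lin //.
apply: (irr_of_degree2 (x := x) (y := y)) => //; first exact: cfRepr_char.
  by rewrite cfRepr1.
by rewrite cfunE groupR // mulr1n.
Qed.

(** The characters of the labels are recorded because the renaming later matches them with explicit
    matrices. *)
Theorem tetra_mckay :
  exists2 lab : quiver_PC m -> mckay_quiver r, quiver_iso lab &
    forall n,
    [/\ 'chi_(lab (Alpha n%:R)) = lam ^+ n,
        'chi_(lab (Varrho n%:R)) = lam ^+ n * rho
      & 'chi_(lab (Varsigma n%:R)) = lam ^+ n * (rho ^+ 2 - 1)].
Proof.
have [Dexp Dker Dnker [t Gt Dt] _] := r_tetra.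
(* The order d of [lam t] divides 3m; conversely the determinant is the square of [lam t], so its
   order 3m divides d. *)
have lam_t : (3 * m).-primitive_root (lam t).
  have [|d pd dvd_d] := prim_order_exists _ (sqrt_det_exp Gt); first by lia.
  suff <- : d = (3 * m)%N by [].
  apply/eqP; rewrite eqn_dvd dvd_d (prim_order_dvd Dt) -sqrt_detK // exprAC.
  by rewrite (prim_expr_order pd) expr1n eqxx.
have ker g : g \in G -> lam g ^+ m = 1 -> rho g = 0 \/ rho g ^+ 2 = 4.
  move=> Gg /eqP; rewrite sqrt_det_exp_m // => /eqP/(Dker _ Gg) => trg.
  have := rho_sqr Gg; case: trg => ->.
    move/eqP; rewrite expr0n /= mulf_eq0 (negPf (det_neq0 Gg)) sqrf_eq0.
    by move=> /eqP R0; left.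
  by rewrite mulrC => /(mulIf (det_neq0 Gg)) R4; right.
have nker g : g \in G -> lam g ^+ m != 1 -> rho g ^+ 2 = 1.
  move=> Gg; rewrite sqrt_det_exp_m // => /(Dnker _ Gg) trg.
  by apply: (mulfI (det_neq0 Gg)); rewrite rho_sqr // mulr1.
have rho1 : rho 1%g = 2.
  by rewrite cfunE lin_char1 ?cfConjC_lin_char ?sqrt_det_lin // mul1r cfRepr1.
have irrE := tetra_irrE m_gt1 sqrt_det_lin tetra_rho_irr rho1 Gt lam_t
  sqrt_det_exp ker nker.
exists (tetra_irr lam rho (m := m)).
  apply: (tetra_irr_mckay m_gt1 sqrt_det_lin tetra_rho_irr rho1 Gt lam_t
    sqrt_det_exp ker nker cardG).
  exact: cfRepr_tetra.
move=> n; split; rewrite irrE.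
- exact: (tetra_char_AlphaE _ m_gt1 sqrt_det_exp).
- exact: (tetra_char_VarrhoE _ m_gt1 sqrt_det_exp).
- exact: (tetra_char_VarsigmaE m_gt1 nker).
Qed.
End TetrahedralRepresentation.

(** * The correspondence of the two quivers *)

Section Correspondence.

Variable m : nat.
Hypotheses (m_gt1 : (1 < m)%N) (m_odd : odd m).

Let m3_gt1 : (1 < 3 * m)%N.
Proof. by rewrite (leq_trans m_gt1) ?leq_pmull. Qed.

Let Zp_lt n (q : 'Z_n) : (1 < n)%N -> (q < n)%N.
Proof. by move=> n_gt1; rewrite -[X in (_ < X)%N](Zp_cast n_gt1) ltn_ord. Qed.

Definition Zp_reduce (q : 'Z_(3 * m)) : 'Z_m := (q : nat)%:R.

(** As m divides 3m, a prior reduction modulo 3m is harmless; hence [Zp_reduce] respects the ring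
    operations. *)
Lemma Zp_reduce_nat n : Zp_reduce n%:R = n%:R.
Proof.
rewrite /Zp_reduce val_Zp_nat //; apply: val_inj => /=.
by rewrite !val_Zp_nat // modn_dvdm ?dvdn_mull.
Qed.

Lemma Zp_reduceD q r : Zp_reduce (q + r) = Zp_reduce q + Zp_reduce r.
Proof. by rewrite -{1}[q]natr_Zp -{1}[r]natr_Zp -natrD Zp_reduce_nat natrD. Qed.

Lemma Zp_reduceM q r : Zp_reduce (q * r) = Zp_reduce q * Zp_reduce r.
Proof. by rewrite -{1}[q]natr_Zp -{1}[r]natr_Zp -natrM Zp_reduce_nat natrM. Qed.

Lemma Zp_reduce1 : Zp_reduce 1 = 1.
Proof. exact: (Zp_reduce_nat 1). Qed.

Lemma Zp_reduceN q : Zp_reduce (- q) = - Zp_reduce q.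
Proof.
by apply/eqP; rewrite -addr_eq0 -Zp_reduceD addNr (Zp_reduce_nat 0).
Qed.

(** The residues s, m + s and 2m + s are distinct and are exactly the lifts of s to the integers
    modulo 3m, so at most one summand is 1. *)
Lemma count_lifts (r e : 'Z_(3 * m)) (s : 'Z_m) :
  ((r == (s : nat)%:R + e)%R + (r == m%:R + (s : nat)%:R + e)%R
   + (r == (2 * m)%:R + (s : nat)%:R + e)%R)%N = (Zp_reduce (r - e) == s).
Proof.
rewrite -!natrD -!(subr_eq r _ e); move: (r - e) => {r e} r.
have valE n : (n < 3 * m)%N -> (r == n%:R) = (r == n :> nat).
  by move=> n_lt; rewrite -val_eqE /= val_Zp_nat // modn_small.
have r_lt := Zp_lt r m3_gt1; have s_lt := Zp_lt s m_gt1.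
rewrite !valE; [|lia..].
rewrite -val_eqE /= val_Zp_nat //.
move: (r : nat) (s : nat) r_lt s_lt => {valE}r {}s r_lt s_lt.
(* The quotient of r by m, which is 0, 1 or 2, tells which lift r is. *)
rewrite {1 2 3}(divn_eq r m); have := ltn_pmod r (ltnW m_gt1).
have : (r %/ m < 3)%N by rewrite ltn_divLR // ltnW.
move: (r %/ m)%N (r %% m)%N => d u; by case: d => [|[|[|]]] // _ u_lt; lia.
Qed.

(** Modulo 3m, [a] is the inverse of -2 and [b] the inverse of 2; modulo m, [a'] is the inverse of
    -2. *)
Let a : 'Z_(3 * m) := ((3 * m - 1)./2)%:R.
Let b : 'Z_(3 * m) := ((3 * m + 1)./2)%:R.
Let a' : 'Z_m := ((m - 1)./2)%:R.

Lemma Zp_half_inv : - 2 * a = 1.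
Proof.
apply/eqP; rewrite mulNr eq_sym -addr_eq0 -natrM -(natrD _ 1).
rewrite (_ : (1 + _ = 3 * m)%N); last by have := m_odd; lia.
by rewrite -val_eqE /= val_Zp_nat // modnn.
Qed.

Lemma Zp_half_inv' : - 2 * a' = 1.
Proof.
apply/eqP; rewrite mulNr eq_sym -addr_eq0 -natrM -(natrD _ 1).
rewrite (_ : (1 + _ = m)%N); last by have := m_odd; lia.
by rewrite -val_eqE /= val_Zp_nat // modnn.
Qed.

Lemma Zp_halfS : b = a + 1.
Proof. by rewrite natr1; congr _%:R; have := m_odd; lia. Qed.

(** Both sides are inverses of -2 modulo m. *)
Lemma Zp_half_reduce : Zp_reduce a = a'.
Proof.
have E : - 2 * Zp_reduce a = 1.
  by rewrite -[LHS]/(- (2%:R) * _) -(Zp_reduce_nat 2) -Zp_reduceN -Zp_reduceM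
             Zp_half_inv Zp_reduce1.
by rewrite -[LHS]mul1r -Zp_half_inv' mulrAC E mul1r.
Qed.

(** The correspondence multiplies the difference tested by an arrow condition by a unit c; such
    conditions are equivalent. *)
Lemma eq_scaled (R : comNzRingType) (c d x y u v : R) :
  d * c = 1 -> u - v = c * (x - y) -> (u == v) = (x == y).
Proof.
move=> dc uv; apply/eqP/eqP => E; apply/eqP; rewrite -subr_eq0.
  by rewrite -[x - y]mul1r -dc -mulrA -uv E subrr mulr0.
by rewrite uv E subrr mulr0.
Qed.

Lemma correspondence_iso : quiver_iso (@correspondence m).
Proof.
split.
  exists (fun s : quiver_T m => match s with
    | Vtx_w i => Alpha (- 2 * i)
    | Vtx_v i => Varrho (- 2 * (i - b))
    | Vtx_u i => Varsigma (- 2 * (i - 1)) end).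
  - by case=> q /=; rewrite ?addrK mulrA ?Zp_half_inv ?Zp_half_inv' mul1r.
  - by case=> i /=; rewrite mulrCA mulrA ?Zp_half_inv ?Zp_half_inv' mul1r ?subrK.
have zero : 2 * a + 1 = 0.
  by transitivity (1 - - 2 * a); [ring | rewrite Zp_half_inv subrr].
have zero' : 2 * a' + 1 = 0.
  by transitivity (1 - - 2 * a'); [ring | rewrite Zp_half_inv' subrr].
(* Four pairs of constructors carry arrows. [count_lifts] turns each triple of arrows into one
   congruence modulo m; leftover constants vanish by [zero] and [zero']. *)
case=> q [] r; unfold arrows, quiver_T, quiver_PC, correspondence, arrows_T,
  arrows_PC => //; rewrite -/a -/b -/a' ?count_lifts; congr (nat_of_bool _).
- apply: (eq_scaled Zp_half_inv); rewrite Zp_halfS.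
  by rewrite -[RHS]addr0 -[in RHS]zero; ring.
- by apply: (eq_scaled Zp_half_inv); rewrite Zp_halfS; ring.
- apply: (eq_scaled Zp_half_inv'); rewrite -!/(Zp_reduce _).
  by rewrite Zp_halfS !Zp_reduceD Zp_reduceM Zp_half_reduce Zp_reduce1; ring.
- apply: (eq_scaled Zp_half_inv'); rewrite Zp_halfS !Zp_reduceD !Zp_reduceN.
  rewrite Zp_reduceM Zp_half_reduce Zp_reduce1.
  by rewrite -[RHS]addr0 -[in RHS]zero'; ring.
Qed.

End Correspondence.

(** * The group T_m *)

Definition mx2 (a b c d : algC) : 'M[algC]_2 :=
  mx_of_seqs 2 [:: [:: a; b]; [:: c; d]].

Lemma mx2M a b c d a' b' c' d' :
  mx2 a b c d * mx2 a' b' c' d' =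
  mx2 (a * a' + b * c') (a * b' + b * d') (c * a' + d * c') (c * b' + d * d').
Proof.
apply/matrixP => i j; rewrite !mxE !big_ord_recl big_ord0 !mxE /= addr0.
by case: i j => [[|[|[]]] //= ?] [[|[|[]]] //= ?].
Qed.

Lemma mx2Z e a b c d : e *: mx2 a b c d = mx2 (e * a) (e * b) (e * c) (e * d).
Proof.
by apply/matrixP=> -[[|[|[]]] //= ?] [[|[|[]]] //= ?]; rewrite !mxE.
Qed.

Lemma mx2D a b c d a' b' c' d' :
  mx2 a b c d + mx2 a' b' c' d' = mx2 (a + a') (b + b') (c + c') (d + d').
Proof.
by apply/matrixP=> -[[|[|[]]] //= ?] [[|[|[]]] //= ?]; rewrite !mxE.
Qed.

Lemma mx2_scalar e : e%:M = mx2 e 0 0 e.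
Proof.
by apply/matrixP=> -[[|[|[]]] //= ?] [[|[|[]]] //= ?]; rewrite !mxE.
Qed.

Lemma mx2_N1 : -1 = mx2 (-1) 0 0 (-1).
Proof. by rewrite -mx2_scalar raddfN. Qed.

Lemma mx2_tr a b c d : \tr (mx2 a b c d) = a + d.
Proof. by rewrite /mxtrace !big_ord_recl big_ord0 !mxE /= addr0. Qed.

Lemma mx2_det a b c d : \det (mx2 a b c d) = a * d - b * c.
Proof.
rewrite (expand_det_row _ ord0) !big_ord_recl big_ord0 /cofactor !det_mx11 !mxE /=.
by rewrite expr0 expr1; ring.
Qed.

Lemma mx2_eta (A : 'M[algC]_2) :
  A = mx2 (A ord0 ord0) (A ord0 ord_max) (A ord_max ord0) (A ord_max ord_max).
Proof.
apply/matrixP=> -[[|[|[]]] //= ?] [[|[|[]]] //= ?]; rewrite !mxE /=;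
  congr (A _ _); exact: val_inj.
Qed.

(** The commutator of anticommuting matrices is -1, of trace -2. *)
Lemma trace_commutator_neq2 (gT : finGroupType) (G : {group gT})
    (r : mx_representation algC G 2) x y :
  x \in G -> y \in G -> r x * r y = - (r y * r x) -> \tr (r [~ x, y]%g) != 2.
Proof.
move=> Gx Gy anti.
have Gyx : (y * x)%g \in G by rewrite groupM.
have E : r (y * x)%g *m r [~ x, y]%g = r (y * x)%g *m (- 1%:M).
  by rewrite -repr_mxM ?groupR // -commgC !repr_mxM // mulmxN mulmx1.
have /(congr1 (mulmx (invmx (r (y * x)%g)))) := E.
rewrite !mulKmx ?repr_mx_unit // => ->; rewrite raddfN /= mxtrace1.
by rewrite -subr_eq0 -opprD oppr_eq0 -natrD pnatr_eq0.
Qed.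

(** * The groups [BD4] and [BT]: products, determinants and traces *)

Lemma quat_ii : quat_i * quat_i = -1.
Proof.
have ii := @sqrCi algC; rewrite mx2_N1 -!/(mx2 _ _ _ _) mx2M.
by congr mx2; rewrite -?ii; ring.
Qed.
Lemma quat_jj : quat_j * quat_j = -1.
Proof.
have ii := @sqrCi algC; rewrite mx2_N1 -!/(mx2 _ _ _ _) mx2M.
by congr mx2; rewrite -?ii; ring.
Qed.
Lemma quat_ji : quat_j * quat_i = - (quat_i * quat_j).
Proof.
rewrite -scaleN1r /quat_i /quat_j -!/(mx2 _ _ _ _) !mx2M mx2Z.
by congr mx2; ring.
Qed.

(** Representatives of [BD4] modulo sign. *)
Definition quats := [:: 1; quat_i; quat_j; quat_i * quat_j].

Lemma BD4P g :
  reflect (exists (b : bool) q, q \in quats /\ g = (-1) ^+ b *: q) (g \in BD4).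
Proof.
apply: (iffP allpairsP) => [[[s q] /= [s_in q_in ->]]|[b [q [q_in ->]]]].
  move: s_in; rewrite !inE => /orP[]/eqP->; [exists false | exists true];
  by exists q.
exists ((-1) ^+ b, q); split=> //=.
by case: b; rewrite !inE ?expr1 ?expr0 eqxx ?orbT.
Qed.

Lemma BD4_N g : g \in BD4 -> - g \in BD4.
Proof.
move=> /BD4P[b [q [q_in ->]]]; apply/BD4P; exists (~~ b), q; split=> //.
by rewrite signrN scaleNr.
Qed.

Lemma BD4_quats q : q \in quats -> q \in BD4.
Proof. by move=> q_in; apply/BD4P; exists false, q; rewrite scale1r. Qed.

Lemma BD4_M g h : g \in BD4 -> h \in BD4 -> g * h \in BD4.
Proof.
have mem q := BD4_quats (q := q).
have quatsM q q' : q \in quats -> q' \in quats -> q * q' \in BD4.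
  have IJI : quat_i * quat_j * quat_i = quat_j.
    by rewrite -mulrA quat_ji mulrN mulrA quat_ii mulN1r opprK.
  have quatsE p : p \in quats ->
      [\/ p = 1, p = quat_i, p = quat_j | p = quat_i * quat_j].
    by rewrite !inE => /or4P[]/eqP->; [apply: Or41|apply: Or42|apply: Or43|apply: Or44].
  move=> /quatsE[]-> /quatsE[]->;
  rewrite ?mul1r ?mulr1 ?mulrA ?quat_ji ?IJI ?mulNr ?quat_ii ?quat_jj
    ?mulNr ?mul1r ?IJI;
  rewrite -?mulrA ?quat_jj ?mulrN ?mulr1 ?quat_ji ?opprK;
  by do ?apply: BD4_N; apply: mem; rewrite !inE eqxx ?orbT.
move=> /BD4P[b [q [q_in ->]]] /BD4P[b' [q' [q'_in ->]]].
rewrite -scalerAl -scalerAr scalerA -signr_addb.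
by case: (b (+) b'); rewrite ?scaleN1r ?scale1r ?BD4_N ?quatsM.
Qed.

Lemma BD4_1 : 1 \in BD4.
Proof. by rewrite BD4_quats ?inE ?eqxx. Qed.

(** Each element squares to 1 or -1, so it is its own inverse up to sign. *)
Lemma BD4_unit g : g \in BD4 -> exists2 h, h \in BD4 & g * h = 1 /\ h * g = 1.
Proof.
have quatsV q : q \in quats -> q * q = 1 \/ q * q = -1.
  rewrite !inE => /or4P[]/eqP->; [by left; rewrite mulr1 | right..].
  - exact: quat_ii.
  - exact: quat_jj.
  - by rewrite -mulrA (mulrA quat_j) quat_ji mulNr mulrN -!mulrA quat_jj mulrN1
       mulrN opprK quat_ii.
move=> /BD4P[b [q [q_in ->]]].
case: (quatsV q q_in) => qq.
  exists ((-1) ^+ b *: q); first by apply/BD4P; exists b, q.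
  by rewrite -!scalerAl -!scalerAr scalerA -signr_addb addbb scale1r qq.
exists (- ((-1) ^+ b *: q)); first by rewrite BD4_N //; apply/BD4P; exists b, q.
by rewrite mulrN mulNr -!scalerAl -!scalerAr scalerA -signr_addb addbb scale1r qq opprK.
Qed.

Lemma BD4_V g : g \in BD4 -> g^-1 \in BD4.
Proof.
case/BD4_unit => h h_in [gh hg].
suff -> : g^-1 = h by [].
have Ug : g \is a GRing.unit by apply/unitrP; exists h.
by apply: (mulrI Ug); rewrite divrr.
Qed.

Lemma BD4_is_unit g : g \in BD4 -> g \is a GRing.unit.
Proof. by case/BD4_unit => h _ [gh hg]; apply/unitrP; exists h. Qed.

Lemma BD4_det_tr g : g \in BD4 ->
  \det g = 1 /\ (\tr g = 0 \/ \tr g ^+ 2 = 4).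
Proof.
have ii := @sqrCi algC.
move=> /BD4P[b [q [q_in ->]]].
have -> : \det ((-1) ^+ b *: q) = \det q by rewrite detZ sqrr_sign mul1r.
have -> : \tr ((-1) ^+ b *: q) = (-1) ^+ b * \tr q by rewrite mxtraceZ.
move: q_in; rewrite !inE => /or4P[]/eqP->.
- rewrite det1 mxtrace1; split=> //; right.
  by rewrite exprMn sqrr_sign mul1r; ring.
- rewrite /quat_i -/(mx2 _ _ _ _) mx2_det mx2_tr; split; last by left; ring.
  by rewrite mulrN -expr2 ii; ring.
- rewrite /quat_j -/(mx2 _ _ _ _) mx2_det mx2_tr; split; last by left; ring.
  by transitivity (- 'i ^+ 2 : algC); [ring | rewrite ii opprK].
- rewrite /quat_i /quat_j -!/(mx2 _ _ _ _) mx2M mx2_det mx2_tr.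
  split; last by left; ring.
  by transitivity (('i ^+ 2) ^+ 2 : algC); [ring | rewrite ii; ring].
Qed.

(** The elements of [BT] outside [BD4] have order 3 or 6, hence trace -1 or 1. The proof clears the
    factor 1/2 and checks each representative modulo sign. *)
Lemma tau_tr g : g \in BD4 -> \tr (tau * g) ^+ 2 = 1 /\ \tr (tau ^+ 2 * g) ^+ 2 = 1.
Proof.
have ii := @sqrCi algC.
have ii4 : 'i ^+ 4 = 1 :> algC by rewrite (exprM _ 2 2) ii sqrrN expr1n.
have half (T : algC) : T ^+ 2 = 4 -> (2^-1 * T) ^+ 2 = 1.
  move=> T4; rewrite exprMn T4 exprVn (_ : 4 = 2 ^+ 2); last by ring.
  by rewrite mulVf ?expf_neq0 ?pnatr_eq0.
have tauE : tau = 2^-1 *: mx2 (1 - 'i) (1 - 'i) (- 1 - 'i) (1 + 'i) by [].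
have tau2E : tau ^+ 2 = 2^-1 *: mx2 (- 1 - 'i) (1 - 'i) (- 1 - 'i) ('i - 1).
  rewrite expr2 tauE -scalerAl -scalerAr scalerA mx2M.
  transitivity ((2^-1 * 2^-1 * 2 : algC) *:
                mx2 (- 1 - 'i) (1 - 'i) (- 1 - 'i) ('i - 1)).
    rewrite -[RHS]scalerA mx2Z; congr (_ *: mx2 _ _ _ _);
      by [ring | rewrite -[in RHS]ii; ring].
  by rewrite -mulrA mulVf ?pnatr_eq0 // mulr1.
move=> /BD4P[b [q [q_in ->]]].
rewrite tau2E tauE -!scalerAr -!scalerAl !mxtraceZ !exprMn sqrr_sign !mul1r.
rewrite -!exprMn.
suff : \tr (mx2 (1 - 'i) (1 - 'i) (- 1 - 'i) (1 + 'i) * q) ^+ 2 = 4 /\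
       \tr (mx2 (- 1 - 'i) (1 - 'i) (- 1 - 'i) ('i - 1) * q) ^+ 2 = 4.
  by case=> /half-> /half->.
move: q_in; rewrite !inE => /or4P[]/eqP->;
  rewrite ?mulr1 /quat_i /quat_j -!/(mx2 _ _ _ _) ?mx2M ?mx2_tr.
- by split; ring.
(* This trace and the ones below equal -2 times the square of ['i] as polynomials; only then is
   ['i ^+ 4 = 1] used. *)
- by split; (transitivity (4 * 'i ^+ 4 : algC); [ring | rewrite ii4 mulr1]).
- by split; (transitivity (4 * 'i ^+ 4 : algC); [ring | rewrite ii4 mulr1]).
- by split; (transitivity (4 * 'i ^+ 4 : algC); [ring | rewrite ii4 mulr1]).
Qed.

Lemma BD4_i : quat_i \in BD4.
Proof. by rewrite BD4_quats // !inE eqxx orbT. Qed.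

Lemma BD4_j : quat_j \in BD4.
Proof. by rewrite BD4_quats // !inE eqxx !orbT. Qed.

Lemma tau_det : \det tau = 1.
Proof.
have ii := @sqrCi algC.
have -> : tau = 2^-1 *: mx2 (1 - 'i) (1 - 'i) (- 1 - 'i) (1 + 'i) by [].
rewrite detZ mx2_det.
have -> : (1 - 'i) * (1 + 'i) - (1 - 'i) * (- 1 - 'i) = 2 ^+ 2 :> algC.
  by transitivity (2 - 2 * 'i ^+ 2 : algC); [ring | rewrite ii; ring].
by rewrite -exprMn mulVf ?pnatr_eq0 // expr1n.
Qed.

Lemma BTP g : g \in BT -> exists n d, [/\ (n < 3)%N, d \in BD4 & g = tau ^+ n * d].
Proof.
case/allpairsP => -[n d] /= [n_in d_in ->]; exists n, d; split=> //.
by move: n_in; rewrite !inE => /or3P[]/eqP->.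
Qed.

Lemma BD4_sub_BT d : d \in BD4 -> d \in BT.
Proof.
by move=> d_in; apply/allpairsP; exists (0%N, d); split=> //=; rewrite mul1r.
Qed.

Lemma BT_det g : g \in BT -> \det g = 1.
Proof.
case/BTP => n [d [_ /BD4_det_tr[d1 _] ->]]; rewrite det_mulmx d1 mulr1.
by elim: n => [|n IHn]; rewrite ?expr0 ?det1 // exprS det_mulmx tau_det IHn mulr1.
Qed.

Lemma BT_tr g : g \in BT ->
  if g \in BD4 then \tr g = 0 \/ \tr g ^+ 2 = 4 else \tr g ^+ 2 = 1.
Proof.
move=> /BTP[n [d [n_lt d_in Eg]]].
case: ifPn => [/BD4_det_tr[] //|].
rewrite Eg; case: n n_lt {Eg} => [|[|[|]]] // _; first by rewrite expr0 mul1r d_in.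
  by rewrite expr1; case: (tau_tr d_in).
by case: (tau_tr d_in).
Qed.

Lemma BT_unit g : g \in BT -> g \is a GRing.unit.
Proof. by move=> /BT_det g1; rewrite -[_ \is a _]/(_ \in unitmx) unitmxE g1 unitr1. Qed.

(** * The inclusion of T_m in U(2) as a tetrahedral representation *)

Section Tm.

Variables (m : nat) (phi : algC -> 'M[algC]_2).
Hypotheses (m_gt1 : (1 < m)%N) (m_odd : odd m).
Hypothesis phi_iso : represents_isomorphism m phi.

(** Membership in [BD4] is constant on cosets, and [phi a] lies in it exactly for a in C_2m. *)
Lemma phi_coset_BD4 a g : Cn (6 * m) a -> g \in BT -> same_coset_BD4 (phi a) g ->
  (g \in BD4) = (a ^+ (2 * m) == 1).
Proof.
have [BTa _ phiD _] := phi_iso.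
move=> aC gB ag; rewrite -[RHS]phiD //.
have Ua : phi a \is a GRing.unit by rewrite BT_unit ?BTa.
apply/idP/idP => D; last by rewrite -[g](mulVKr Ua) BD4_M.
have := BD4_M D (BD4_V ag).
have Ua' : (phi a)^-1 \is a GRing.unit by rewrite unitrV.
by rewrite (invrM Ua' (BT_unit gB)) invrK mulVKr ?BT_unit.
Qed.

Variables (gT : finGroupType) (G : {group gT}) (r : mx_representation algC G 2).
Hypothesis G_Tm : is_Tm m phi r.

(** The element a h has determinant a^2 and trace a tr h, so the m-th power a^(2m) of its
    determinant decides whether h is in [BD4]. *)
Lemma Tm_tetra_repr : tetra_repr m r.
Proof.
have [BTa phiM phiD phi_surj] := phi_iso.
have [_ imG] := G_Tm.
have elt g : g \in G -> exists a h, [/\ Cn (6 * m) a, h \in BT,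
    (h \in BD4) = (a ^+ (2 * m) == 1) & r g = a *: h].
  move=> Gg; have [|a [h [aC hB ah ->]]] := (imG (r g)).1; first by exists g.
  by exists a, h; split=> //; apply: phi_coset_BD4.
have detE a h : h \in BT -> \det (a *: h) = a ^+ 2.
  by move=> /BT_det h1; rewrite detZ h1 mulr1.
split.
- move=> g /elt[a [h [/eqP aC hB _ ->]]].
  by rewrite detE // -exprM mulnA.
- move=> g /elt[a [h [aC hB hD ->]]]; rewrite detE // -exprM => /eqP a2.
  have := BT_tr hB; rewrite hD a2 mxtraceZ.
  by case=> E; [left | right]; rewrite ?E ?mulr0 // exprMn E mulrC.
- move=> g /elt[a [h [aC hB hD ->]]]; rewrite detE // -exprM => /negPf a2.
  by have := BT_tr hB; rewrite hD a2 mxtraceZ exprMn => ->; rewrite mulr1.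
(* For a primitive 6m-th root of unity l, the element l phi(l) has determinant l^2, of order 3m. *)
- have [|l pl] := @C_prim_root_exists (6 * m); first by rewrite muln_gt0 (ltnW m_gt1).
  have lC : Cn (6 * m) l by apply/eqP/prim_expr_order.
  have [|t Gt Et] := (imG (l *: phi l)).2.
    exists l, (phi l); split; rewrite ?BTa // /same_coset_BD4.
    by rewrite mulVr ?BD4_1 ?BT_unit ?BTa.
  exists t => //; rewrite Et detE ?BTa //.
  have := exp_prim_root pl 2; rewrite (gcdn_idPl _) ?dvdn_mulr //.
  by rewrite (_ : 6 * m = 3 * m * 2)%N ?mulnK // mulnAC.
- have C1 : Cn (6 * m) 1 by rewrite /Cn expr1n.
  (* Paired with the scalar 1, all of [BD4] lies in T_m; [quat_i] and [quat_j] anticommute. *)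
  have inG q : q \in BD4 -> exists2 x, x \in G & r x = q.
    move=> q_in; have [|x Gx Ex] := (imG q).2; last by exists x.
    exists 1, q; split; rewrite ?scale1r ?BD4_sub_BT // /same_coset_BD4.
    by rewrite BD4_M ?BD4_V // phiD // /Cn expr1n.
  have [x Gx Ex] := inG _ BD4_i.
  have [y Gy Ey] := inG _ BD4_j.
  exists x, y; split=> //; apply: trace_commutator_neq2 => //.
  by rewrite Ex Ey quat_ji opprK.
Qed.

(** Since a h = (-a)(-h) and, for m odd, one of a and -a is a 3m-th root of unity, every element
    arises from one of 3m scalars and the 8 elements of a coset. *)
Lemma Tm_card : (#|G| <= 24 * m)%N.
Proof.
have [BTa phiM phiD phi_surj] := phi_iso.
have [faithG imG] := G_Tm.
have [|l pl] := @C_prim_root_exists (3 * m); first by rewrite muln_gt0 (ltnW m_gt1).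
pose L := [seq l ^+ i *: (phi (l ^+ i) * d) | i <- iota 0 (3 * m), d <- BD4].
have sizeL : size L = (24 * m)%N by rewrite size_allpairs size_iota /=; lia.
suff sub g : g \in G -> r g \in L.
  rewrite -sizeL cardE -(size_map r); apply: uniq_leq_size.
    rewrite map_inj_in_uniq ?enum_uniq // => g h.
    by rewrite !mem_enum; apply: mx_faithful_inj.
  by move=> _ /mapP[g Gg ->]; apply: sub; rewrite -mem_enum.
move=> Gg; have [|a [h [aC hB ah ->]]] := (imG (r g)).1; first by exists g.
have inL b d : b ^+ (3 * m) = 1 -> d \in BD4 -> b *: (phi b * d) \in L.
  move=> /(prim_rootP pl)[i ->] d_in; apply/allpairsP; exists (i : nat, d).
  by split=> //; rewrite mem_iota add0n ltn_ord.
have Ua : phi a \is a GRing.unit by rewrite BT_unit ?BTa.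
have Eh : h = phi a * ((phi a)^-1 * h) by rewrite mulVKr.
have : (a ^+ (3 * m)) ^+ 2 == 1 by rewrite -exprM mulnAC.
rewrite sqrf_eq1 => /orP[]/eqP a3; first by rewrite Eh inL.
have bC : Cn (6 * m) (- 1).
  by rewrite /Cn -signr_odd oddM /= expr0 eqxx.
have naC : Cn (6 * m) (a * -1) by rewrite /Cn exprMn (eqP aC) (eqP bC) mulr1 eqxx.
have na3 : (a * -1) ^+ (3 * m) = 1.
  by rewrite exprMn a3 -signr_odd oddM m_odd /= mulrNN mulr1.
have D1 : phi (-1) \in BD4.
  by rewrite phiD // /Cn -signr_odd oddM /= expr0 eqxx.
have Una : phi (a * -1) \is a GRing.unit by rewrite BT_unit ?BTa.
have -> : a *: h = (a * -1) *: (phi (a * -1) * ((phi (a * -1))^-1 * - h)).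
  by rewrite mulVKr // mulrN1 scalerN scaleNr opprK.
(* [phi (a * -1)] and [phi a] share a coset because [phi (-1)] lies in [BD4]. *)
apply: inL => //; rewrite Eh -mulrN mulrA BD4_M ?BD4_N //.
rewrite -[_ * phi a](mulrK (BD4_is_unit D1)) BD4_M ?BD4_V // -mulrA.
exact: phiM.
Qed.

End Tm.

(** * The group P' x C_l *)

Section VarrhoMatrices.

Variable w : algC.
Hypothesis w_prim : 3.-primitive_root w.

(** The equation 1 + w + w^2 = 0, oriented as a reduction rule for [ring]. *)
Lemma cube_root_sqr : w ^+ 2 = - 1 - w.
Proof.
have w3 := prim_expr_order w_prim.
have w1 : w - 1 != 0.
  rewrite subr_eq0 -[w]expr1; apply/eqP => E.
  by have /eqP := E; rewrite -(prim_order_dvd w_prim).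
apply: (mulfI w1); transitivity (w ^+ 3 - w ^+ 2); first by ring.
by rewrite w3; ring.
Qed.

Let X := varrho_x w.
Let Y := varrho_y w.
Let Z := varrho_z w 1.

Lemma varrho_zE e : varrho_z w e = e *: Z.
Proof. by rewrite /Z /varrho_z scale1r. Qed.

Lemma varrho_z1 : Z = mx2 0 w (- w ^+ 2) (-1).
Proof. by rewrite /Z /varrho_z scale1r. Qed.

Lemma varrho_xx : X * X = -1.
Proof.
rewrite /X /varrho_x mx2_N1 -!/(mx2 _ _ _ _) mx2M.
by congr mx2; ring: cube_root_sqr.
Qed.

Lemma varrho_yy : Y * Y = -1.
Proof.
rewrite /Y /varrho_y mx2_N1 -!/(mx2 _ _ _ _) mx2M.
by congr mx2; ring: cube_root_sqr.
Qed.

Lemma varrho_xy : X * Y = - (Y * X).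
Proof.
rewrite -scaleN1r /X /Y /varrho_y /varrho_x -!/(mx2 _ _ _ _) !mx2M mx2Z.
by congr mx2; ring: cube_root_sqr.
Qed.

(** The characteristic equation for trace -1 and determinant 1; it gives Z^3 = 1. *)
Lemma varrho_zz : Z * Z = - 1 - Z.
Proof.
rewrite -[- Z]scaleN1r varrho_z1 mx2_N1 mx2M mx2Z mx2D.
by congr mx2; ring: cube_root_sqr.
Qed.

Lemma varrho_zzz : Z ^+ 3 = 1.
Proof.
rewrite !exprS expr0 mulr1 varrho_zz mulrBr mulrN1 varrho_zz opprB opprK.
by rewrite addKr.
Qed.

Lemma varrho_det_x : \det X = 1.
Proof.
rewrite /X /varrho_x -!/(mx2 _ _ _ _) mx2_det; ring: cube_root_sqr.
Qed.

Lemma varrho_det_y : \det Y = 1.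
Proof.
rewrite /Y /varrho_y -!/(mx2 _ _ _ _) mx2_det; ring: cube_root_sqr.
Qed.

Lemma varrho_det_z : \det Z = 1.
Proof. rewrite varrho_z1 mx2_det; ring: cube_root_sqr. Qed.

(** As Z^3 = 1 and X^2 = Y^2 = -1, exponents reduce modulo 3 and 2 up to a sign, to which the claims
    are insensitive; twelve products remain. *)
Lemma varrho_tr n a b :
  if (3 %| n)%N then \tr (Z ^+ n * X ^+ a * Y ^+ b) = 0 \/
                     \tr (Z ^+ n * X ^+ a * Y ^+ b) ^+ 2 = 4
  else \tr (Z ^+ n * X ^+ a * Y ^+ b) ^+ 2 = 1.
Proof.
have s := cube_root_sqr.
have -> : Z ^+ n = Z ^+ (n %% 3).
  by rewrite {1}(divn_eq n 3) exprD mulnC exprM varrho_zzz expr1n mul1r.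
have red (A : 'M[algC]_2) c : A * A = -1 ->
    exists d : nat, A ^+ c = (-1) ^+ d *: A ^+ odd c.
  move=> AA; exists c./2.
  rewrite -{1}(odd_double_half c) exprD -mul2n exprM expr2 AA.
  by rewrite -scaleN1r exprZn expr1n -scalerAr mulr1.
have [d ->] := red X a varrho_xx; have [d' ->] := red Y b varrho_yy.
rewrite -scalerAr -scalerAr -scalerAl scalerA mxtraceZ exprMn -exprD sqrr_sign mul1r.
suff : let T := \tr (Z ^+ (n %% 3) * X ^+ odd a * Y ^+ odd b) in
    if (3 %| n)%N then T = 0 \/ T ^+ 2 = 4 else T ^+ 2 = 1.
  move=> /=; case: ifP => // _ [->|->]; last by right.
  by left; rewrite mulr0.
rewrite /dvdn; have := ltn_pmod n (isT : 0 < 3)%N.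
case: (n %% 3)%N => [|[|[|//]]] _ /=; rewrite ?expr0 ?mul1r ?expr1.
- case: (odd a); case: (odd b); rewrite ?expr0 ?expr1 ?mul1r ?mulr1;
    rewrite /X /Y /varrho_y /varrho_x -?/(mx2 _ _ _ _) ?mx2M ?mx2_tr ?mxtrace1;
    by [left; ring: s | right; ring: s].
- case: (odd a); case: (odd b); rewrite ?expr0 ?expr1 ?mul1r ?mulr1;
    rewrite varrho_z1 /X /Y /varrho_y /varrho_x -?/(mx2 _ _ _ _) ?mx2M ?mx2_tr;
    by ring: s.
- case: (odd a); case: (odd b); rewrite ?expr0 ?expr1 ?mul1r ?mulr1;
    rewrite [Z ^+ 2]expr2 varrho_zz -[- Z]scaleN1r varrho_z1 mx2_N1;
    rewrite /X /Y /varrho_y /varrho_x -?/(mx2 _ _ _ _);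
    rewrite mx2Z mx2D ?mx2M mx2_tr;
    by ring: s.
Qed.

End VarrhoMatrices.

(** * Normal form and order bound for the presented group *)

Section BinaryTetrahedralExtension.

Variables (k : nat) (gT : finGroupType) (P : {group gT}) (x y z : gT).
Hypothesis P'_P : is_P' k P x y z.

Lemma P'_mem : [/\ x \in P, y \in P & z \in P].
Proof.
have [_ gP _ _ _] := P'_P.
by split; rewrite gP mem_gen // !inE eqxx ?orbT.
Qed.

Lemma P'_xyx : (x * y * x = y)%g.
Proof.
have [_ _ [_ xy2] _ _] := P'_P.
by apply: (mulIg y); rewrite -[RHS]/(y ^+ 2)%g -xy2 -[RHS]/(x * y * (x * y))%g !mulgA.
Qed.

Lemma P'_y2 : (y ^+ 2 = x ^+ 2)%g.
Proof. by have [_ _ [x2 <-] _ _] := P'_P. Qed.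

(** Squaring y = xyx gives y^2 = x y^4 x. With y^2 = x^2 this reads x^2 = x^6. *)
Lemma P'_x4 : (x ^+ 4 = 1)%g.
Proof.
have xx : (x * x = y * y)%g by rewrite [LHS](esym P'_y2).
have y2E : (y ^+ 2 = x * y ^+ 4 * x)%g.
  rewrite -[in LHS]P'_xyx -[LHS]/(x * y * x * (x * y * x))%g.
  by rewrite -!mulgA (mulgA x x) xx -!mulgA.
have y4 : (y ^+ 4 = x ^+ 4)%g by rewrite (expgM y 2 2) P'_y2 -expgM.
have x6 : (x ^+ 4 * x ^+ 2 = x ^+ 2)%g.
  by rewrite -[RHS]P'_y2 y2E y4 -expgS -expgSr -expgD.
by apply: (mulIg (x ^+ 2)%g); rewrite mul1g.
Qed.

(** The element z normalises Q, generated by x and y, and y inverts x by xyx = y; hence P is the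
    product of the cyclic groups of z, x and y. *)
Lemma P'_normal_form g : g \in P -> exists n a b,
  [/\ (n < 3 ^ k)%N, (a < 4)%N, (b < 2)%N & g = (z ^+ n * x ^+ a * y ^+ b)%g].
Proof.
have [_ gP [_ xy2] [zx zy] zk] := P'_P.
have yz : (y * z = z * x)%g by rewrite -zx mulgKV.
have xz : (x * z = z * (y * x^-1))%g.
  apply: (mulIg x); rewrite -!mulgA mulVg mulg1 -yz mulgA -zy mulgKV //.
pose Q := <<[set x; y]>>%g.
have [Qx Qy] : x \in Q /\ y \in Q by rewrite !mem_gen // !inE eqxx ?orbT.
have NQz : z \in 'N(Q).
  rewrite inE -genJ gen_subG; apply/subsetP => _ /imsetP[u u_in ->].
  move: u_in; rewrite !inE => /orP[]/eqP->; rewrite conjgE.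
    by rewrite xz mulKg groupM ?groupV.
  by rewrite yz mulKg.
have QE : Q = (<[x]> * <[y]>)%g.
  have Ny : <[y]>%g \subset 'N(<[x]>).
    rewrite cycle_subG inE -cycleJ cycle_subG.
    have -> : (x ^ y = x^-1)%g; last by rewrite groupV cycle_id.
    by rewrite conjgE; apply: (mulgI y); rewrite mulKVg -{2}P'_xyx mulgK.
  by rewrite -norm_joinEr // /cycle joing_idl joing_idr joingE.
suff : g \in P -> g \in (<[z]> * Q)%g; last first.
  rewrite -norm_joinEl ?cycle_subG // joingE.
  move: g; apply/subsetP; rewrite gP gen_subG; apply/subsetP => u.
  rewrite !inE -orbA => /or3P[]/eqP->; rewrite mem_gen // inE ?Qx ?Qy ?orbT //.
  by rewrite cycle_id.
move=> PQ /PQ; case/mulsgP => _ q /cycleP[n ->]; rewrite QE.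
case/mulsgP => _ _ /cycleP[a ->] /cycleP[b ->] -> ->.
(* The even part of the exponent of y moves to x, as y^2 = x^2. *)
exists (n %% 3 ^ k)%N, ((a + b %/ 2 * 2) %% 4)%N, (b %% 2)%N.
rewrite !ltn_pmod ?expn_gt0 //; split=> //.
rewrite (expg_mod _ zk) (expg_mod _ P'_x4) expgD -!mulgA; congr (_ * (_ * _))%g.
by rewrite {1}(divn_eq b 2) expgD mulnC !expgM P'_y2.
Qed.

Lemma P'_card : (#|P| <= 8 * 3 ^ k)%N.
Proof.
pose L := [seq (z ^+ nab.1 * x ^+ nab.2.1 * y ^+ nab.2.2)%g |
  nab <- [seq (n, ab) | n <- iota 0 (3 ^ k),
           ab <- [seq (a, b) | a <- iota 0 4, b <- iota 0 2]]].
have sizeL : size L = (8 * 3 ^ k)%N.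
  by rewrite size_map size_allpairs size_iota mulnC.
rewrite -sizeL (leq_trans _ (card_size L)) //; apply/subset_leq_card/subsetP => g.
case/P'_normal_form => n [a [b [n_lt a_lt b_lt ->]]].
apply/mapP; exists (n, (a, b)) => //.
by rewrite !allpairs_f // mem_iota.
Qed.

End BinaryTetrahedralExtension.

(** * The natural representation of the product group *)

Section ProductGroup.

Variables (m k l : nat) (zeta : nat -> algC).
Hypotheses (def_m : m = (3 ^ (k - 1) * l)%N) (l_odd : odd l) (co_3l : gcdn 3 l = 1%N).
Hypothesis k_gt0 : (0 < k)%N.
Hypothesis zeta_prim : forall n, (0 < n)%N -> n.-primitive_root (zeta n).
Variables (gT cT : finGroupType) (P : {group gT}) (x y z : gT) (c : cT).
Hypothesis P'_P : is_P' k P x y z.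
Hypothesis ord_c : #[c]%g = l.
Variable r : mx_representation algC (PC P c) 2.

Let w := zeta 3.
Let e := zeta (3 ^ k).
Let b := zeta l.
Let X := varrho_x w.
Let Y := varrho_y w.
Let Z := varrho_z w 1.

Hypothesis r_def : is_product_repr x y z X Y (varrho_z w (e ^+ 1)) (b ^+ 1) r.

Let w_prim : 3.-primitive_root w. Proof. exact: zeta_prim. Qed.
Let e_prim : (3 ^ k).-primitive_root e.
Proof. by apply: zeta_prim; rewrite expn_gt0. Qed.
Let l_gt0 : (0 < l)%N. Proof. exact: odd_gt0. Qed.
Let b_prim : l.-primitive_root b. Proof. exact: zeta_prim. Qed.
Let def_3m : (3 * m = 3 ^ k * l)%N.
Proof. by rewrite def_m mulnA -expnS subn1 prednK. Qed.
Let co_3kl : coprime (3 ^ k) l.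
Proof. by rewrite coprimeXl // /coprime co_3l. Qed.

Lemma PC_card : (#|PC P c| <= 24 * m)%N.
Proof.
rewrite cardsX -[#|<[c]>%g|]/(#[c]%g) ord_c (_ : 24 * m = 8 * 3 ^ k * l)%N.
  by rewrite leq_mul2r (P'_card P'_P) orbT.
by rewrite -mulnA -def_3m mulnA.
Qed.

Lemma PC_gens : [/\ (x, 1%g) \in PC P c, (y, 1%g) \in PC P c,
  (z, 1%g) \in PC P c & (1%g, c) \in PC P c].
Proof.
have [Px Py Pz] := P'_mem P'_P.
by rewrite !inE /= Px Py Pz !group1 cycle_id.
Qed.

(** The same exponent n occurs on e and on Z, which ties the determinant to the trace. *)
Lemma r_normal_form g : g \in PC P c -> exists n i j h,
  r g = (e ^+ n * b ^+ h) *: (Z ^+ n * X ^+ i * Y ^+ j).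
Proof.
have [Gx Gy Gz Gc] := PC_gens.
have [rx ry rz rc] := r_def.
case: g => u v; rewrite !inE /= => /andP[Pu /cycleP[h ->]].
have [n [i [j [_ _ _ ->]]]] := P'_normal_form P'_P Pu.
exists n, i, j, h.
have -> : ((z ^+ n * x ^+ i * y ^+ j)%g, (c ^+ h)%g) =
    ((z, 1) ^+ n * (x, 1) ^+ i * (y, 1) ^+ j * (1, c) ^+ h)%g.
  have pairX (p : gT * cT) q : (p ^+ q = (p.1 ^+ q, p.2 ^+ q))%g.
    by elim: q => [|q IHq]; rewrite ?expg0 // !expgS IHq.
  rewrite !pairX /= !expg1n [RHS]surjective_pairing /=.
  by rewrite !mulg1 !mul1g.
rewrite !repr_mxM ?groupM ?groupX // !repr_mxX // rx ry rz rc varrho_zE !expr1.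
rewrite [(e *: Z) ^+ n]exprZn -scalemx1 [(b *: _) ^+ h]exprZn expr1n.
rewrite -scalemxAr mulmx1 -!scalemxAl scalerA.
by rewrite mulrC.
Qed.

Lemma det_r_scaled a n i j : \det (a *: (Z ^+ n * X ^+ i * Y ^+ j)) = a ^+ 2.
Proof.
have detX (A : 'M[algC]_2) q : \det A = 1 -> \det (A ^+ q) = 1.
  move=> A1; elim: q => [|q IHq]; first by rewrite expr0 det1.
  by rewrite exprS det_mulmx A1 IHq mulr1.
rewrite detZ !det_mulmx !detX ?mulr1 //.
- exact: varrho_det_y.
- exact: varrho_det_x.
- exact: varrho_det_z.
Qed.

Lemma scalar_exp n h : (e ^+ n * b ^+ h) ^+ (3 * m) = 1.
Proof.
rewrite exprMn -!exprM def_3m mulnCA exprM (prim_expr_order e_prim) expr1n.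
by rewrite mulnA mulnC exprM (prim_expr_order b_prim) expr1n mulr1.
Qed.

(** As l divides m, the factor b disappears; as e has order 3^k, what remains is 3 | 2nl, with 2l
    prime to 3. *)
Lemma scalar_exp_m n h : ((e ^+ n * b ^+ h) ^+ 2 ^+ m == 1) = (3 %| n)%N.
Proof.
rewrite -exprM exprMn -!exprM.
rewrite (_ : (h * (2 * m) = l * (h * 2 * 3 ^ (k - 1)))%N); last first.
  by rewrite def_m; ring.
rewrite [b ^+ _]exprM (prim_expr_order b_prim) expr1n mulr1.
rewrite -(prim_order_dvd e_prim) (_ : (n * (2 * m) = n * (2 * l) * 3 ^ (k - 1))%N).
  rewrite -{1}(prednK k_gt0) -subn1 expnS dvdn_pmul2r ?expn_gt0 //.
  by rewrite Gauss_dvdl // coprimeMr /= /coprime co_3l.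
by rewrite def_m; ring.
Qed.

(** If d is the order, raising (be)^(2d) = 1 to the powers l and 3^k isolates e and b; coprimality
    then yields 3^k | d and l | d. *)
Lemma scalar_prim : (3 * m).-primitive_root ((b * e) ^+ 2).
Proof.
have be1 : (b * e) ^+ 2 ^+ (3 * m) = 1.
  by have := scalar_exp 1 1; rewrite !expr1 mulrC exprAC => ->; rewrite expr1n.
have m3_gt0 : (0 < 3 * m)%N by rewrite def_3m muln_gt0 expn_gt0 l_gt0.
have [d pd d_dvd] := prim_order_exists m3_gt0 be1.
suff <- : d = (3 * m)%N by [].
apply/eqP; rewrite eqn_dvd d_dvd def_3m Gauss_dvd //=.
have bed : b ^+ (2 * d) * e ^+ (2 * d) = 1.
  by rewrite -exprMn exprM (prim_expr_order pd).
have co_2 : coprime 2 (3 ^ k) by rewrite coprimeXr.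
have co_2l : coprime l 2 by rewrite coprimen2.
have el : e ^+ (2 * d * l) = 1.
  have := congr1 (fun u => u ^+ l) bed; rewrite exprMn expr1n exprAC.
  by rewrite (prim_expr_order b_prim) expr1n mul1r -exprM.
have bk : b ^+ (2 * d * 3 ^ k) = 1.
  have := congr1 (fun u => u ^+ (3 ^ k)) bed; rewrite exprMn expr1n.
  by rewrite [e ^+ _ ^+ _]exprAC (prim_expr_order e_prim) expr1n mulr1 -exprM.
move/eqP: el; move/eqP: bk.
rewrite -(prim_order_dvd e_prim) -(prim_order_dvd b_prim).
rewrite Gauss_dvdl 1?coprime_sym // Gauss_dvdr // => ->.
by rewrite Gauss_dvdl // Gauss_dvdr 1?coprime_sym // => ->.
Qed.

Lemma PC_tetra_repr : tetra_repr m r.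
Proof.
have [Gx Gy Gz Gc] := PC_gens.
have [rx ry rz rc] := r_def.
split.
- move=> g /r_normal_form[n [i [j [h ->]]]].
  by rewrite det_r_scaled -exprM mulnC exprM scalar_exp expr1n.
- move=> g /r_normal_form[n [i [j [h ->]]]].
  rewrite det_r_scaled mxtraceZ => /eqP; rewrite scalar_exp_m => n3.
  have := varrho_tr w_prim n i j; rewrite n3.
  by case=> E; [left | right]; rewrite ?E ?mulr0 // exprMn E mulrC.
- move=> g /r_normal_form[n [i [j [h ->]]]].
  rewrite det_r_scaled mxtraceZ scalar_exp_m => /negPf n3.
  have := varrho_tr w_prim n i j; rewrite n3 exprMn => ->.
  by rewrite mulr1.
(* This element has determinant (be)^2, as Z has determinant 1. *)
- exists ((z, 1) * (1, c))%g; first by rewrite groupM.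
  rewrite repr_mxM // rz rc mul_mx_scalar varrho_zE scalerA detZ varrho_det_z //.
  by rewrite mulr1 !expr1 scalar_prim.
- exists (x, 1%g), (y, 1%g); split=> //; apply: trace_commutator_neq2 => //.
  by rewrite rx ry varrho_xy.
Qed.
End ProductGroup.

(** * Symmetric squares *)

Lemma twist_mx_repr (gT : finGroupType) (G : {group gT}) (mu : 'CF(G)) n
    (r : mx_representation algC G n) :
  mu \is a linear_char -> mx_repr G (fun g => mu g *: r g).
Proof.
move=> lin_mu; split=> [|g h Gg Gh]; first by rewrite lin_char1 // repr_mx1 scale1r.
by rewrite lin_charM // repr_mxM // -scalemxAl -scalemxAr scalerA.
Qed.

Definition twist_repr (gT : finGroupType) (G : {group gT}) (mu : 'CF(G)) n
    (r : mx_representation algC G n) (lin_mu : mu \is a linear_char) :=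
  MxRepresentation (twist_mx_repr r lin_mu).

Lemma cfRepr_twist (gT : finGroupType) (G : {group gT}) (mu : 'CF(G)) n
    (r : mx_representation algC G n) (lin_mu : mu \is a linear_char) :
  cfRepr (twist_repr r lin_mu) = mu * cfRepr r.
Proof. by apply/cfun_inP => g Gg; rewrite !cfunE Gg /= mxtraceZ. Qed.

Lemma trivial_mx_repr (gT : finGroupType) (G : {group gT}) :
  mx_repr G (fun _ : gT => 1%:M : 'M[algC]_1).
Proof. by split=> // g h _ _; rewrite mulmx1. Qed.

Definition mx3 (a b c d e f g h i : algC) : 'M[algC]_3 :=
  mx_of_seqs 3 [:: [:: a; b; c]; [:: d; e; f]; [:: g; h; i]].

Lemma mx3M a b c d e f g h i a' b' c' d' e' f' g' h' i' :
  mx3 a b c d e f g h i *m mx3 a' b' c' d' e' f' g' h' i' =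
  mx3 (a * a' + b * d' + c * g') (a * b' + b * e' + c * h') (a * c' + b * f' + c * i')
      (d * a' + e * d' + f * g') (d * b' + e * e' + f * h') (d * c' + e * f' + f * i')
      (g * a' + h * d' + i * g') (g * b' + h * e' + i * h') (g * c' + h * f' + i * i').
Proof.
apply/matrixP => p q; rewrite !mxE !big_ord_recl big_ord0 !mxE /= addr0 addrA.
by case: p q => [[|[|[|[]]]] //= ?] [[|[|[|[]]]] //= ?].
Qed.

Lemma mx3Z u a b c d e f g h i :
  u *: mx3 a b c d e f g h i =
  mx3 (u * a) (u * b) (u * c) (u * d) (u * e) (u * f) (u * g) (u * h) (u * i).
Proof.
by apply/matrixP => -[[|[|[|[]]]] //= ?] [[|[|[|[]]]] //= ?]; rewrite !mxE.
Qed.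

Lemma mx3_scalar u : u%:M = mx3 u 0 0 0 u 0 0 0 u.
Proof.
by apply/matrixP => -[[|[|[|[]]]] //= ?] [[|[|[|[]]]] //= ?]; rewrite !mxE.
Qed.

Lemma mx3_tr a b c d e f g h i : \tr (mx3 a b c d e f g h i) = a + e + i.
Proof. by rewrite /mxtrace !big_ord_recl big_ord0 !mxE /= addr0 addrA. Qed.

(* The symmetric square, in the basis u^2, uv, v^2; matrices act on rows. *)
Definition sym2_mx (A : 'M[algC]_2) : 'M[algC]_3 :=
  let a := A ord0 ord0 in let b := A ord0 ord_max in
  let c := A ord_max ord0 in let d := A ord_max ord_max in
  mx3 (a ^+ 2) (2 * (a * b)) (b ^+ 2)
      (a * c) (a * d + b * c) (b * d)
      (c ^+ 2) (2 * (c * d)) (d ^+ 2).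

Lemma sym2_mx2 a b c d :
  sym2_mx (mx2 a b c d) =
  mx3 (a ^+ 2) (2 * (a * b)) (b ^+ 2) (a * c) (a * d + b * c) (b * d)
      (c ^+ 2) (2 * (c * d)) (d ^+ 2).
Proof. by rewrite /sym2_mx !mxE. Qed.

Lemma sym2_mxM A B : sym2_mx (A *m B) = sym2_mx A *m sym2_mx B.
Proof.
rewrite (mx2_eta A) (mx2_eta B) [_ *m _]mx2M !sym2_mx2 mx3M.
by congr mx3; ring.
Qed.

Lemma sym2_mxZ u A : sym2_mx (u *: A) = u ^+ 2 *: sym2_mx A.
Proof.
rewrite (mx2_eta A) mx2Z !sym2_mx2 mx3Z.
by congr mx3; ring.
Qed.

Lemma sym2_mx1 : sym2_mx 1%:M = 1%:M.
Proof. by rewrite mx2_scalar mx3_scalar sym2_mx2; congr mx3; ring. Qed.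

(** Divided by the determinant, this trace is the character [rho ^+ 2 - 1]. *)
Lemma sym2_mx_tr A : \tr (sym2_mx A) = \tr A ^+ 2 - \det A.
Proof. by rewrite (mx2_eta A) sym2_mx2 mx3_tr mx2_tr mx2_det; ring. Qed.

(** * The three-dimensional matrices as symmetric squares *)

Section VarsigmaMatrices.

Variable w : algC.
Hypothesis w_prim : 3.-primitive_root w.

(* The change of basis from the symmetric square of varrho_0 to varsigma_0,
   unique up to a scalar: it solves [K * sym2 A = B * K] for the images A, B of
   x, y and z. *)
Definition sym2_base : 'M[algC]_3 :=
  mx3 w (- 1 - 2 * w) 0 (w ^+ 2) 1 w 1 (-1) 1.
Definition sym2_base_inv : 'M[algC]_3 :=
  2^-1 *: mx3 (1 + w) (1 + 2 * w) (2 + w) (1 + 2 * w) w (1 + w) w (- 1 - w) 1.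

Definition varsigma_mx (A : 'M[algC]_2) : 'M[algC]_3 :=
  sym2_base *m sym2_mx A *m sym2_base_inv.

Lemma sym2_baseK : sym2_base_inv *m sym2_base = 1%:M.
Proof.
have s := cube_root_sqr w_prim.
rewrite /sym2_base_inv /sym2_base -scalemxAl mx3M; apply: (canLR (scalerK _)).
  by rewrite pnatr_eq0.
by rewrite scalemx1 mx3_scalar; congr mx3; ring: s.
Qed.

Lemma sym2_baseVK : sym2_base *m sym2_base_inv = 1%:M.
Proof. by apply: mulmx1C; apply: sym2_baseK. Qed.

Lemma varsigma_mxM A B : varsigma_mx (A *m B) = varsigma_mx A *m varsigma_mx B.
Proof.
rewrite /varsigma_mx sym2_mxM -!mulmxA; congr (_ *m (_ *m _)).
by rewrite [RHS]mulmxA sym2_baseK mul1mx.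
Qed.

Lemma varsigma_mx1 : varsigma_mx 1%:M = 1%:M.
Proof. by rewrite /varsigma_mx sym2_mx1 mulmx1 sym2_baseVK. Qed.

Lemma varsigma_mxZ u A : varsigma_mx (u *: A) = u ^+ 2 *: varsigma_mx A.
Proof. by rewrite /varsigma_mx sym2_mxZ -(scalemxAr (u ^+ 2)) -scalemxAl. Qed.

Lemma varsigma_mx_tr A : \tr (varsigma_mx A) = \tr A ^+ 2 - \det A.
Proof. by rewrite mxtrace_mulC mulmxA sym2_baseK mul1mx sym2_mx_tr. Qed.

(** Replaces the conjugation by an intertwining equation free of the inverse matrix. *)
Lemma varsigma_mxP A B :
  sym2_base *m sym2_mx A = B *m sym2_base -> varsigma_mx A = B.
Proof. by rewrite /varsigma_mx => ->; rewrite -mulmxA sym2_baseVK mulmx1. Qed.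

Lemma varsigma_mx_x : varsigma_mx (varrho_x w) = varsigma_x.
Proof.
have s := cube_root_sqr w_prim; apply: varsigma_mxP.
rewrite sym2_mx2 !mx3M.
by congr mx3; ring: s.
Qed.

Lemma varsigma_mx_y : varsigma_mx (varrho_y w) = varsigma_y.
Proof.
have s := cube_root_sqr w_prim; apply: varsigma_mxP.
rewrite sym2_mx2 !mx3M.
by congr mx3; ring: s.
Qed.

Lemma varsigma_mx_z : varsigma_mx (varrho_z w 1) = varsigma_z 1.
Proof.
have s := cube_root_sqr w_prim; apply: varsigma_mxP.
rewrite varrho_z1 sym2_mx2 /varsigma_z scale1r !mx3M.
by congr mx3; ring: s.
Qed.

Lemma varsigma_mx_repr (gT : finGroupType) (G : {group gT})
    (r : mx_representation algC G 2) : mx_repr G (fun g => varsigma_mx (r g)).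
Proof.
split=> [|g h Gg Gh]; first by rewrite repr_mx1 varsigma_mx1.
by rewrite repr_mxM // varsigma_mxM.
Qed.

End VarsigmaMatrices.

(** * The renaming of the irreducible representations *)

Lemma mx_rsim_irr (gT : finGroupType) (G : {group gT}) n
    (r : mx_representation algC G n) (i : Iirr G) :
  cfRepr r = 'chi_i -> mx_rsim r 'Chi_i.
Proof. by move=> Er; apply: cfRepr_inj; rewrite irrRepr. Qed.

Section Renaming.

Variables (m k l : nat) (zeta : nat -> algC).
Hypotheses (m_gt1 : (1 < m)%N) (m_odd : odd m).
Hypotheses (def_m : m = (3 ^ (k - 1) * l)%N) (l_odd : odd l) (co_3l : gcdn 3 l = 1%N).
Hypothesis k_gt0 : (0 < k)%N.
Hypothesis zeta_prim : forall n, (0 < n)%N -> n.-primitive_root (zeta n).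
Variables (gT cT : finGroupType) (P : {group gT}) (x y z : gT) (c : cT).
Hypothesis P'_P : is_P' k P x y z.
Hypothesis ord_c : #[c]%g = l.
Variable r : mx_representation algC (PC P c) 2.

Let w := zeta 3.
Let e := zeta (3 ^ k).
Let b := zeta l.

Hypothesis r_def : is_product_repr x y z (varrho_x w) (varrho_y w)
  (varrho_z w (e ^+ 1)) (b ^+ 1) r.

Let w_prim : 3.-primitive_root w. Proof. exact: zeta_prim. Qed.
Let e_prim : (3 ^ k).-primitive_root e.
Proof. by apply: zeta_prim; rewrite expn_gt0. Qed.
Let l_gt0 : (0 < l)%N. Proof. exact: odd_gt0. Qed.
Let b_prim : l.-primitive_root b. Proof. exact: zeta_prim. Qed.
Let def_3m : (3 * m = 3 ^ k * l)%N.
Proof. by rewrite def_m mulnA -expnS subn1 prednK. Qed.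
Let co_3kl : coprime (3 ^ k) l.
Proof. by rewrite coprimeXl // /coprime co_3l. Qed.

Let lam := sqrt_det m r.
Let lin_lam : lam \is a linear_char := sqrt_det_lin m r.
Let lin_lamV : lam^*%CF \is a linear_char.
Proof. by rewrite cfConjC_lin_char. Qed.

Let sqrt_sqr (u : algC) : u ^+ (3 * m) = 1 -> u ^+ 2 ^+ (3 * m).+1./2 = u.
Proof.
move=> u1; rewrite -exprM mul2n halfK oddS oddM m_odd subn0.
by rewrite exprS u1 mulr1.
Qed.

Let gens := PC_gens c P'_P.

(** The determinants are 1, 1, e^2 and b^2, so [lam] is alpha_1 x beta_1. *)
Lemma lam_gens :
  [/\ lam (x, 1%g) = 1, lam (y, 1%g) = 1, lam (z, 1%g) = e & lam (1%g, c) = b].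
Proof.
have [Gx Gy Gz Gc] := gens; have [rx ry rz rc] := r_def.
rewrite /lam !exp_cfunE // !det_reprE // rx ry rz rc.
rewrite varrho_det_x // varrho_det_y // !expr1n varrho_zE detZ varrho_det_z //.
rewrite mulr1 det_scalar !expr1 !sqrt_sqr //.
  by rewrite def_3m mulnC exprM (prim_expr_order b_prim) expr1n.
by rewrite def_3m exprM (prim_expr_order e_prim) expr1n.
Qed.

Lemma lamV_gens g : g \in PC P c -> lam g * (lam^*)%CF g = 1.
Proof.
move=> Gg; have := congr1 (fun f : 'CF(PC P c) => f g) (mul_conjC_lin_char lin_lam).
by rewrite cfunE cfun1E Gg.
Qed.

Variable lab : quiver_PC m -> Iirr (PC P c).
Hypothesis labE : forall n,
    [/\ 'chi_(lab (Alpha n%:R)) = lam ^+ n,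
        'chi_(lab (Varrho n%:R)) = lam ^+ n * (lam^*%CF * cfRepr r)
      & 'chi_(lab (Varsigma n%:R)) =
          lam ^+ n * ((lam^*%CF * cfRepr r) ^+ 2 - 1)].

Let pow_e n i : n = i %[mod 3 ^ k] -> e ^+ n = e ^+ i.
Proof. by move=> E; apply/eqP; rewrite (eq_prim_root_expr e_prim) E. Qed.

Let pow_b n j : n = j %[mod l] -> b ^+ n = b ^+ j.
Proof. by move=> E; apply/eqP; rewrite (eq_prim_root_expr b_prim) E. Qed.

(** The power lam^n depends only on n modulo 3^k, through e, and modulo l, through b. *)
Lemma lab_Alpha n i j : n = i %[mod 3 ^ k] -> n = j %[mod l] ->
  product_irr x y z alpha_x alpha_y (alpha_z (e ^+ i)) (b ^+ j)
    (lab (Alpha n%:R)).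
Proof.
move=> n_i n_j; have [Gx Gy Gz Gc] := gens; have [lx ly lz lc] := lam_gens.
have lin_n : lam ^+ n \is a linear_char by rewrite rpredX.
exists (twist_repr (MxRepresentation (trivial_mx_repr (PC P c))) lin_n).
  split; rewrite /= exp_cfunE // ?lx ?ly ?lz ?lc ?expr1n ?scale1r //.
    by rewrite (pow_e n_i) scalemx1.
  by rewrite (pow_b n_j) scalemx1.
apply: mx_rsim_irr; have [-> _ _] := labE n; rewrite cfRepr_twist.
apply/cfun_inP => g Gg; rewrite !cfunE Gg /= mxtrace1.
by rewrite mulr1.
Qed.

Lemma lab_Varrho n i j : n = i %[mod 3 ^ k] -> n = j %[mod l] ->
  product_irr x y z (varrho_x w) (varrho_y w) (varrho_z w (e ^+ i)) (b ^+ j)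
    (lab (Varrho n%:R)).
Proof.
move=> n_i n_j; have [Gx Gy Gz Gc] := gens; have [lx ly lz lc] := lam_gens.
have [rx ry rz rc] := r_def.
(* The conjugate of [lam] cancels the scalars e and b already present in [r]. *)
have lin_n : lam ^+ n * lam^*%CF \is a linear_char.
  by apply: rpredM => //; apply: rpredX.
exists (twist_repr r lin_n).
  have V := lamV_gens.
  split; rewrite /= cfunE exp_cfunE //.
  - by have := V _ Gx; rewrite lx mul1r => ->; rewrite expr1n mulr1 scale1r.
  - by have := V _ Gy; rewrite ly mul1r => ->; rewrite expr1n mulr1 scale1r.
  - rewrite rz varrho_zE expr1 scalerA lz (pow_e n_i) -mulrA [_ * e]mulrC.
    by have := V _ Gz; rewrite lz => ->; rewrite mulr1 -varrho_zE.
  - rewrite rc expr1 -scalemx1 scalerA lc (pow_b n_j) -mulrA [_ * b]mulrC.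
    by have := V _ Gc; rewrite lc => ->; rewrite mulr1 scalemx1.
apply: mx_rsim_irr; have [_ -> _] := labE n.
by rewrite cfRepr_twist mulrA.
Qed.

Lemma lab_Varsigma n s j : n = s %[mod 3 ^ (k - 1)] -> n = j %[mod l] ->
  product_irr x y z varsigma_x varsigma_y (varsigma_z (e ^+ s)) (b ^+ j)
    (lab (Varsigma n%:R)).
Proof.
move=> n_s n_j; have [Gx Gy Gz Gc] := gens; have [lx ly lz lc] := lam_gens.
have [rx ry rz rc] := r_def.
(* The index modulo m fixes s only modulo 3^(k-1). The representative q is congruent to s modulo
   3^k, so that e^q is e^s itself. *)
pose q := chinese (3 ^ k) l s j.
have q_s : q = s %[mod 3 ^ k] by apply: chinese_modl.
have q_j : q = j %[mod l] by apply: chinese_modr.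
have q_s' : q = s %[mod 3 ^ (k - 1)].
  have dvd3 : (3 ^ (k - 1) %| 3 ^ k)%N by rewrite dvdn_exp2l ?leq_subr.
  by rewrite -(modn_dvdm _ dvd3) q_s modn_dvdm.
have -> : n%:R = q%:R :> 'Z_m.
  apply: val_inj; rewrite /= !val_Zp_nat //; apply/eqP; rewrite {1 2}def_m.
  rewrite chinese_remainder; last by rewrite coprimeXl // /coprime co_3l.
  by rewrite n_s q_s' n_j q_j !eqxx.
(* The symmetric square squares the scalars e and b, hence two inverse factors of [lam]. *)
have lin_q : lam ^+ q * lam^*%CF ^+ 2 \is a linear_char.
  by apply: rpredM; apply: rpredX.
exists (twist_repr (MxRepresentation (varsigma_mx_repr w_prim r)) lin_q).
  have V := lamV_gens.
  split; rewrite /= cfunE [(lam ^+ q) _]exp_cfunE // [(lam^*%CF ^+ 2) _]exp_cfunE //.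
  - have := V _ Gx; rewrite lx mul1r => ->; rewrite !expr1n mulr1 scale1r rx.
    exact: varsigma_mx_x.
  - have := V _ Gy; rewrite ly mul1r => ->; rewrite !expr1n mulr1 scale1r ry.
    exact: varsigma_mx_y.
  - rewrite rz varrho_zE expr1 varsigma_mxZ scalerA lz (pow_e q_s) -mulrA -exprMn.
    rewrite [_ * e]mulrC; have := V _ Gz; rewrite lz => ->.
    by rewrite expr1n mulr1 varsigma_mx_z // /varsigma_z scale1r.
  - rewrite rc expr1 -scalemx1 varsigma_mxZ varsigma_mx1 // scalerA lc (pow_b q_j).
    rewrite -mulrA -exprMn [_ * b]mulrC; have := V _ Gc; rewrite lc => ->.
    by rewrite expr1n mulr1 scalemx1.
apply: mx_rsim_irr; have [_ _ ->] := labE q.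
rewrite cfRepr_twist -mulrA; congr (_ * _); apply/cfun_inP => g Gg.
rewrite !cfunE Gg /= varsigma_mx_tr //.
have := sqrt_detK m_odd (PC_tetra_repr def_m l_odd co_3l k_gt0 zeta_prim P'_P r_def) Gg.
rewrite -/lam => <-; rewrite cfun1E Gg !mulr1n mulrBr.
have V := lamV_gens Gg; rewrite cfunE in V.
have V2 : (lam g)^* * (lam g)^* * lam g ^+ 2 = 1.
  by transitivity ((lam g * (lam g)^*) ^+ 2); [ring | rewrite V expr1n].
by rewrite V2; ring.
Qed.

Lemma crt_renaming :
  is_renaming k l zeta x y z (crt_index k l) (crt_index (k - 1) l) lab.
Proof.
have co : coprime (3 ^ (k - 1)) l by rewrite coprimeXl // /coprime co_3l.
split=> i j _ _; last first.
  by apply: lab_Varsigma; [apply: chinese_modl | apply: chinese_modr].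
split; [apply: lab_Alpha | apply: lab_Varrho];
  by [apply: chinese_modl | apply: chinese_modr].
Qed.

(** Modulo l, 3^k is -1, so 3^k p + i becomes i - p, which is j for p = i - j. *)
Lemma formula_index_modl i j : (j < l)%N -> (l %| 3 ^ k + 1)%N ->
  formula_index k l i j = j %[mod l].
Proof.
move=> j_lt l_dvd; rewrite /formula_index; set u := ((i + _) %% l)%N.
have u_def : (u + j = i %[mod l])%N.
  by rewrite modnDml -addnA subnK ?modnDr // ltnW.
apply/eqP; rewrite -(eqn_modDr u); apply/eqP.
rewrite [in RHS]addnC u_def addnAC -[X in (_ + X + _)%N]mul1n -mulnDl.
by rewrite -modnDml -modnMml (eqP l_dvd) mul0n mod0n.
Qed.

Lemma formula_renaming : (l %| 3 ^ k + 1)%N ->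
  is_renaming k l zeta x y z (formula_index k l) (formula_index k l) lab.
Proof.
move=> l_dvd.
have modk i j : formula_index k l i j = i %[mod 3 ^ k].
  by rewrite /formula_index mulnC modnMDl.
split=> i j _ j_lt; last first.
  apply: lab_Varsigma; last exact: formula_index_modl.
  have dvd3 : (3 ^ (k - 1) %| 3 ^ k)%N by rewrite dvdn_exp2l ?leq_subr.
  by rewrite -(modn_dvdm _ dvd3) modk modn_dvdm.
by split; [apply: lab_Alpha | apply: lab_Varrho] => //; apply: formula_index_modl.
Qed.

End Renaming.

(** * The two McKay quivers and their isomorphism *)

Theorem proposition7p9
  (m k l : nat)
  (gcd_m6 : gcdn m 6 = 3%N)
  (def_m : m = (3 ^ (k - 1) * l)%N)
  (odd_l : odd l)
  (co_3l : gcdn 3 l = 1%N)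
  (k_ge2 : (2 <= k)%N)
  (* the roots of unity zeta_n *)
  (zeta : nat -> algC)
  (zeta_prim : forall n, (0 < n)%N -> n.-primitive_root (zeta n))
  (* P' = P'_{8.3^k}, C_l = <[c]> and rho_NAT = varrho_1 x beta_1 *)
  (gT cT : finGroupType) (P : {group gT}) (x y z : gT) (c : cT)
  (P'_P : is_P' k P x y z)
  (ord_c : #[c]%g = l)
  (rNAT : mx_representation algC (PC P c) 2)
  (rNAT_def : is_product_repr x y z
     (varrho_x (zeta 3%N)) (varrho_y (zeta 3%N))
     (varrho_z (zeta 3%N) (zeta (3 ^ k)%N ^+ 1)) (zeta l ^+ 1) rNAT)
  (* T_m and rho_Nat *)
  (phi : algC -> 'M[algC]_2)
  (phi_iso : represents_isomorphism m phi)
  (tT : finGroupType) (T : {group tT}) (rNat : mx_representation algC T 2)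
  (T_Tm : is_Tm m phi rNat) :
  [/\ (* (1) is the McKay quiver of P' x C_l *)
      exists2 lab : quiver_PC m -> mckay_quiver rNAT,
        quiver_iso lab &
        is_renaming k l zeta x y z (crt_index k l) (crt_index (k - 1) l) lab /\
        ((l %| 3 ^ k + 1)%N ->
         is_renaming k l zeta x y z (formula_index k l) (formula_index k l) lab),
      (* (2) is the McKay quiver of T_m *)
      exists lab : quiver_T m -> mckay_quiver rNat, quiver_iso lab
    & (* the correspondence is an isomorphism from (1) to (2) *)
      quiver_iso (@correspondence m)].
Proof.
have m_odd : odd m by rewrite def_m oddM odd_l oddX orbT.
have k_gt0 : (0 < k)%N by apply: ltnW.
have m_gt1 : (1 < m)%N.
  have : (0 < m)%N by apply: odd_gt0.
  (* The value m = 1 contradicts gcd(m, 6) = 3. *)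
  by case: m gcd_m6 {def_m phi_iso T_Tm m_odd} => [|[]].
have corr := correspondence_iso m_gt1 m_odd.
split=> //.
  have tetra := PC_tetra_repr def_m odd_l co_3l k_gt0 zeta_prim P'_P rNAT_def.
  have card := PC_card def_m k_gt0 P'_P ord_c.
  have [lab lab_iso labE] := tetra_mckay m_gt1 m_odd tetra card.
  exists lab => //; split.
    exact: (crt_renaming m_gt1 m_odd def_m odd_l co_3l k_gt0 zeta_prim
      P'_P rNAT_def labE).
  exact: (formula_renaming m_gt1 m_odd def_m odd_l co_3l k_gt0 zeta_prim
      P'_P rNAT_def labE).
(* The criterion labels the irreducible representations of T_m by the vertices of (1); the inverse
   correspondence carries this over to (2). *)
have [lab [lab_bij lab_arr] _] := tetra_mckay m_gt1 m_odd
  (Tm_tetra_repr m_gt1 phi_iso T_Tm) (Tm_card m_gt1 m_odd phi_iso T_Tm).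
have [[f fK Kf] corr_arr] := corr.
exists (lab \o f); split; first by apply: bij_comp => //; exists (@correspondence m).
by move=> s t; rewrite [LHS]lab_arr -corr_arr !Kf.
Qed.
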